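(* Let $R$ be a regular local ring and let $I \subseteq R$ be an ideal. Then $I = I^{\star}$, where $I^{\star}$ denotes the parasolid closure of $I$.
   Context: All rings are commutative with $1$. Parasolid algebras. Let $R$ be a Noetherian local ring of dimension $d$ with maximal ideal $\mathfrak{m}$. Elements $x_1,\ldots,x_d\in R$ are called parameters if $V(x_1,\ldots,x_d)=V(\mathfrak{m})$; they define, via Čech cohomology, a class $1/(x_1\cdots x_d)\in H^d_{\mathfrak m}(R)$, called a paraclass. For an $R$-algebra $A$, $H^d_{\mathfrak m}(A)$ is the local cohomology of $A$ as an $R$-module. $A$ is called parasolid (over the local ring $R$) if every paraclass $0\neq c\in H^d_{\mathfrak m}(R)$ has non-zero image in $H^d_{\mathfrak m}(A)$. For a commutative ring $R$, an $R$-algebra $A$ is universally parasolid if for every Noetherian local ring $R'$ and every ring homomorphism $R\to R'$ the $R'$-algebra $A\otimes_R R'$ is parasolid. Parasolid closure. For $f_1,\ldots,f_n,h$ in a ring $R$, the forcing algebra is $A=R[T_1,\ldots,T_n]/(f_1T_1+\ldots+f_nT_n+h)$. One says $h$ belongs universally parasolidly to $f_1,\ldots,f_n$ if this $A$ is a universally parasolid $R$-algebra. If $R$ is a complete Noetherian local domain and $I=(f_1,\ldots,f_n)$, then the parasolid closure $I^{\star}$ is the set of $h\in R$ for which there is a chain $f_{n+1},\ldots,f_m=h$ in $R$ such that $f_i$ belongs universally parasolidly to $f_1,\ldots,f_{i-1}$ for each $i=n+1,\ldots,m$ (this is an ideal depending only on $I$). For a general Noetherian ring $R$ and an ideal $I$,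 $h\in I^{\star}$ if and only if for every maximal ideal $\mathfrak m$ of $R$ and every minimal prime $\mathfrak q$ of the completion $\hat{R_{\mathfrak m}}$ the image of $h$ lies in the parasolid closure of the extended ideal in $\hat{R_{\mathfrak m}}/\mathfrak q$. *)

(* Defs.v *)
From HB Require Import structures.
From mathcomp Require Import all_boot all_algebra generic_quotient ring_quotient.
From mathcomp Require Import boolp classical_sets.
From mathcomp Require Import ring.
From mathcomp.multinomials Require Import mpoly.

Set Implicit Arguments.
Unset Strict Implicit.
Unset Printing Implicit Defensive.

Import GRing.Theory.
Local Open Scope quotient_scope.
Local Open Scope classical_set_scope.
Local Open Scope ring_scope.

(* Rings are [comPzRingType]s (commutative, with 1, possibly zero): forcing
   algebras and localizations may vanish.  Ideals are classical sets; MathComp's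
   own ideal quotient only covers proper ideals of nonzero rings. *)

Section Ideals.
Context (R : comPzRingType).
Implicit Types (I J P X : set R).

Definition is_ideal I :=
  [/\ I 0, forall a b, I a -> I b -> I (a + b) & forall r a, I a -> I (r * a)].

Definition is_prime P :=
  [/\ is_ideal P, ~ P 1 & forall a b, P (a * b) -> P a \/ P b].

Definition is_maximal P :=
  [/\ is_ideal P, ~ P 1 &
      forall J, is_ideal J -> P `<=` J -> J = P \/ J = setT].

Definition is_minimal_prime P :=
  is_prime P /\ forall Q, is_prime Q -> Q `<=` P -> Q = P.

Definition ideal_gen X : set R :=
  [set a | exists n (c x : 'I_n -> R),
     (forall i, X (x i)) /\ a = \sum_(i < n) c i * x i].

Fixpoint ideal_pow I n : set R :=
  if n is k.+1 then ideal_gen [set a * b | a in ideal_pow I k & b in I]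
  else setT.

(* V(X), the closed subset of Spec R *)
Definition zero_locus X : set (set R) := [set P | is_prime P /\ X `<=` P].

Lemma ideal_gen_ideal X : is_ideal (ideal_gen X).
Proof.
split.
- exists 0, (fun _ => 0), (fun _ => 0).
  by split; [case | rewrite big_ord0].
- move=> a b [n [c [x [Xx ->]]]] [m [d [y [Xy ->]]]].
  exists (n + m)%N, (fun i => match split i with inl j => c j | inr j => d j end),
    (fun i => match split i with inl j => x j | inr j => y j end); split.
    by move=> i; case: (split i).
  rewrite big_split_ord; congr (_ + _); apply: eq_bigr => i _.
    by rewrite (unsplitK (inl i : 'I_n + 'I_m)).
  by rewrite (unsplitK (inr i : 'I_n + 'I_m)).
- move=> r a [n [c [x [Xx ->]]]].
  exists n, (fun i => r * c i), x; split=> //.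
  by rewrite mulr_sumr; apply: eq_bigr => i _; rewrite mulrA.
Qed.

Lemma ideal_pow_ideal I n : is_ideal (ideal_pow I n).
Proof. by case: n => [|n] /=; [split | exact: ideal_gen_ideal]. Qed.

End Ideals.

Record ideal (R : comPzRingType) :=
  Ideal { ideal_set :> set R; idealP : is_ideal ideal_set }.

Record prime_ideal (R : comPzRingType) :=
  PrimeIdeal { prime_set :> set R; primeP : is_prime prime_set }.

Definition ideal_of_prime R (P : prime_ideal R) : ideal R :=
  Ideal (let: And3 h _ _ := primeP P in h).
Definition gen R X : ideal R := Ideal (ideal_gen_ideal X).

Section RingProperties.
Context (R : comPzRingType).

Definition noetherian :=
  forall I : set R, is_ideal I ->
  exists n (f : 'I_n -> R), I = ideal_gen (range f).

Definition prime_chain n (p : nat -> set R) :=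
  (forall i, (i <= n)%N -> is_prime (p i)) /\
  (forall i, (i < n)%N -> p i `<` p i.+1).

Definition krull_dim d :=
  (exists p, prime_chain d p) /\ (forall n p, prime_chain n p -> (n <= d)%N).

Definition local_with (m : set R) :=
  is_maximal m /\ forall m', is_maximal m' -> m' = m.

Definition noetherian_local := noetherian /\ exists m, local_with m.

Definition regular_local :=
  noetherian /\
  exists m d, [/\ local_with m, krull_dim d &
    exists x : 'I_d -> R, m = ideal_gen (range x)].

Definition parameters (m : set R) d (x : 'I_d -> R) :=
  zero_locus (range x) = zero_locus m.

End RingProperties.

(* Quotient of a type carrying ring operations by a congruence modulo which
   they satisfy the ring axioms. *)
Record congruence (T : choiceType) := Congruence {
  cong : T -> T -> Prop;
  c0 : T; cN : T -> T; cD : T -> T -> T; c1 : T; cM : T -> T -> T;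
  cong_refl : forall x, cong x x;
  cong_sym : forall x y, cong x y -> cong y x;
  cong_trans : forall x y z, cong x y -> cong y z -> cong x z;
  congN : forall x x', cong x x' -> cong (cN x) (cN x');
  congD : forall x x' y, cong x x' -> cong (cD x y) (cD x' y);
  congM : forall x x' y, cong x x' -> cong (cM x y) (cM x' y);
  congDA : forall x y z, cong (cD x (cD y z)) (cD (cD x y) z);
  congDC : forall x y, cong (cD x y) (cD y x);
  cong0D : forall x, cong (cD c0 x) x;
  congND : forall x, cong (cD (cN x) x) c0;
  congMA : forall x y z, cong (cM x (cM y z)) (cM (cM x y) z);
  congMC : forall x y, cong (cM x y) (cM y x);
  cong1M : forall x, cong (cM c1 x) x;
  congMDl : forall x y z, cong (cM (cD x y) z) (cD (cM x z) (cM y z))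
}.

Section CongruenceQuotient.
Context (T : choiceType) (C : congruence T).

Definition congb : rel T := fun x y => `[< cong C x y >].

Lemma congb_equiv : equiv_class_of congb.
Proof.
split=> [x|x y|y x z].
- by apply/asboolP; exact: cong_refl.
- by apply: asbool_equiv_eq; split; exact: cong_sym.
- by move=> /asboolP h1 /asboolP h2; apply/asboolP; exact: (cong_trans h1 h2).
Qed.

Canonical congb_rel := EquivRelPack congb_equiv.
Canonical congb_enc := defaultEncModRel congb.

Definition cquot := {eq_quot congb}.
HB.instance Definition _ := Choice.on cquot.
HB.instance Definition _ : EqQuotient T congb cquot := EqQuotient.on cquot.

Definition cclass (x : T) : cquot := \pi_cquot x.

Lemma cclass_eq x y : cclass x = cclass y <-> cong C x y.
Proof.
by split=> [/eqmodP /asboolP|h] //; apply/eqmodP/asboolP.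
Qed.

Lemma cclass_repr (u : cquot) : cclass (repr u) = u.
Proof. exact: reprK. Qed.

Lemma cong_repr x : cong C (repr (cclass x)) x.
Proof. by apply/cclass_eq; rewrite cclass_repr. Qed.

Definition q0 : cquot := cclass (c0 C).
Definition q1 : cquot := cclass (c1 C).
Definition qN (u : cquot) := cclass (cN C (repr u)).
Definition qD (u v : cquot) := cclass (cD C (repr u) (repr v)).
Definition qM (u v : cquot) := cclass (cM C (repr u) (repr v)).

Lemma cclassN x : cclass (cN C x) = qN (cclass x).
Proof. by apply/cclass_eq/congN/cong_sym/cong_repr. Qed.

Lemma cclassD x y : cclass (cD C x y) = qD (cclass x) (cclass y).
Proof.
apply/cclass_eq/(@cong_trans _ _ _ (cD C (repr (cclass x)) y)).
  exact/congD/cong_sym/cong_repr.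
apply: cong_trans (congDC _ _ _) _; apply: cong_trans _ (congDC _ _ _).
exact/congD/cong_sym/cong_repr.
Qed.

Lemma cclassM x y : cclass (cM C x y) = qM (cclass x) (cclass y).
Proof.
apply/cclass_eq/(@cong_trans _ _ _ (cM C (repr (cclass x)) y)).
  exact/congM/cong_sym/cong_repr.
apply: cong_trans (congMC _ _ _) _; apply: cong_trans _ (congMC _ _ _).
exact/congM/cong_sym/cong_repr.
Qed.

Lemma qDA : associative qD.
Proof.
move=> u v w; rewrite -(cclass_repr u) -(cclass_repr v) -(cclass_repr w).
by rewrite -!cclassD; apply/cclass_eq/congDA.
Qed.
Lemma qDC : commutative qD.
Proof. by move=> u v; apply/cclass_eq/congDC. Qed.
Lemma q0D : left_id q0 qD.
Proof. by move=> u; rewrite -(cclass_repr u) -cclassD; apply/cclass_eq/cong0D. Qed.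
Lemma qND : left_inverse q0 qN qD.
Proof.
by move=> u; rewrite -(cclass_repr u) -cclassN -cclassD; apply/cclass_eq/congND.
Qed.

HB.instance Definition _ := GRing.isZmodule.Build cquot qDA qDC q0D qND.

Lemma qMA : associative qM.
Proof.
move=> u v w; rewrite -(cclass_repr u) -(cclass_repr v) -(cclass_repr w).
by rewrite -!cclassM; apply/cclass_eq/congMA.
Qed.
Lemma qMC : commutative qM.
Proof. by move=> u v; apply/cclass_eq/congMC. Qed.
Lemma q1M : left_id q1 qM.
Proof. by move=> u; rewrite -(cclass_repr u) -cclassM; apply/cclass_eq/cong1M. Qed.
Lemma qMDl : left_distributive qM qD.
Proof.
move=> u v w; rewrite -(cclass_repr u) -(cclass_repr v) -(cclass_repr w).
by rewrite -cclassD -!cclassM -cclassD; apply/cclass_eq/congMDl.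
Qed.

HB.instance Definition _ :=
  GRing.Zmodule_isComPzRing.Build cquot qMA qMC q1M qMDl.

Lemma cclass_sub x y : cclass (cD C x (cN C y)) = cclass x - cclass y.
Proof. by rewrite cclassD cclassN. Qed.

Lemma cclass_mul x y : cclass (cM C x y) = cclass x * cclass y.
Proof. exact: cclassM. Qed.

End CongruenceQuotient.

Section IdealQuotient.
Context (R : comPzRingType) (I : ideal R).

Lemma ideal0 : ideal_set I 0. Proof. by case: (idealP I). Qed.
Lemma idealD a b : ideal_set I a -> ideal_set I b -> ideal_set I (a + b).
Proof. by case: (idealP I) => _ h _; exact: h. Qed.
Lemma idealM r a : ideal_set I a -> ideal_set I (r * a).
Proof. by case: (idealP I) => _ _ h; exact: h. Qed.
Lemma idealN a : ideal_set I a -> ideal_set I (- a).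
Proof. by move=> /(idealM (-1)); rewrite mulN1r. Qed.

Definition ideal_cong : congruence R.
Proof.
apply: (@Congruence R (fun a b => ideal_set I (a - b)) 0 -%R +%R 1 *%R).
- by move=> x; rewrite subrr; exact: ideal0.
- by move=> x y /idealN; rewrite opprB.
- by move=> x y z h1 h2; rewrite -(subrKA y); exact: idealD.
- by move=> x x' /idealN; rewrite opprD.
- by move=> x x' y; rewrite opprD addrACA subrr addr0.
- by move=> x x' y /(idealM y); rewrite mulrBr ![y * _]mulrC.
- by move=> x y z; rewrite addrA subrr; exact: ideal0.
- by move=> x y; rewrite [x + y]addrC subrr; exact: ideal0.
- by move=> x; rewrite add0r subrr; exact: ideal0.
- by move=> x; rewrite addNr subrr; exact: ideal0.
- by move=> x y z; rewrite mulrA subrr; exact: ideal0.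
- by move=> x y; rewrite [x * y]mulrC subrr; exact: ideal0.
- by move=> x; rewrite mul1r subrr; exact: ideal0.
- by move=> x y z; rewrite mulrDl subrr; exact: ideal0.
Defined.

Definition iquot : comPzRingType := cquot ideal_cong.
Definition iproj (a : R) : iquot := cclass ideal_cong a.

Lemma iproj_zmod : zmod_morphism iproj.
Proof. by move=> a b; exact: (cclass_sub ideal_cong). Qed.
Lemma iproj_monoid : monoid_morphism iproj.
Proof. by split=> // a b; exact: (cclass_mul ideal_cong). Qed.
HB.instance Definition _ := GRing.isZmodMorphism.Build R iquot iproj iproj_zmod.
HB.instance Definition _ :=
  GRing.isMonoidMorphism.Build R iquot iproj iproj_monoid.

End IdealQuotient.

(* R/q for a prime q, as a nonzero ring: polynomials need nonzero coefficients *)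
Section PrimeQuotient.
Context (R : comPzRingType) (q : prime_ideal R).

Definition pquot := cquot (ideal_cong (ideal_of_prime q)).
HB.instance Definition _ := GRing.ComPzRing.on pquot.

Lemma pquot_neq0 : 1 != 0 :> pquot.
Proof.
apply/eqP => /cclass_eq /=; rewrite subr0.
by case: (primeP q).
Qed.
HB.instance Definition _ := GRing.PzSemiRing_isNonZero.Build pquot pquot_neq0.

Definition pproj (a : R) : pquot := iproj (ideal_of_prime q) a.

End PrimeQuotient.

Record mulset (A : comPzRingType) := MulSet {
  ms_set :> set A;
  ms1 : ms_set 1;
  msM : forall s t, ms_set s -> ms_set t -> ms_set (s * t)
}.

Section Localization.
Context (A : comPzRingType) (S : mulset A).

Definition fraction := {p : A * A | `[< ms_set S p.2 >]}.
HB.instance Definition _ := Choice.on fraction.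
Definition Frac (a s : A) (Ss : ms_set S s) : fraction :=
  exist _ (a, s) (asboolT Ss).
Definition num (u : fraction) : A := (val u).1.
Definition den (u : fraction) : A := (val u).2.
Lemma denP u : ms_set S (den u). Proof. by apply/asboolP; exact: (valP u). Qed.

Definition frac_rel (u v : fraction) :=
  exists t, ms_set S t /\ t * (num u * den v - num v * den u) = 0.

Definition frac_cong : congruence fraction.
Proof.
apply: (@Congruence fraction frac_rel
  (Frac 0 (ms1 S))
  (fun u => Frac (- num u) (denP u))
  (fun u v => Frac (num u * den v + num v * den u) (msM (denP u) (denP v)))
  (Frac 1 (ms1 S))
  (fun u v => Frac (num u * num v) (msM (denP u) (denP v)))); rewrite /frac_rel.
- by move=> x; exists 1; split; [exact: ms1 | ring].
- move=> x y [t [St e]]; exists t; split=> //.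
  by rewrite -opprB mulrN e oppr0.
- move=> x y z [t [St e]] [t' [St' e']].
  exists (t * t' * den y); split; first exact: msM (msM St St') (denP y).
  transitivity (t' * den z * (t * (num x * den y - num y * den x))
     + t * den x * (t' * (num y * den z - num z * den y))); first by ring.
  by rewrite e e'; ring.
- move=> x y [t [St e]]; exists t; split=> //=.
  rewrite /num /den /= -/(num x) -/(num y) -/(den x) -/(den y).
  transitivity (- (t * (num x * den y - num y * den x))); first by ring.
  by rewrite e oppr0.
- move=> x y z [t [St e]]; exists t; split=> //=.
  rewrite /num /den /= -/(num x) -/(num y) -/(den x) -/(den y).
  transitivity (den z * den z * (t * (num x * den y - num y * den x))).
    by rewrite -/(num z) -/(den z); ring.
  by rewrite e mulr0.
- move=> x y z [t [St e]]; exists t; split=> //=.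
  rewrite /num /den /= -/(num x) -/(num y) -/(den x) -/(den y).
  transitivity (num z * den z * (t * (num x * den y - num y * den x))).
    by rewrite -/(num z) -/(den z); ring.
  by rewrite e mulr0.
all: move=> *; exists 1; split; [exact: ms1 | rewrite /num /den /=; ring].
Defined.

Definition loc : comPzRingType := cquot frac_cong.

Definition frac (a s : A) (Ss : ms_set S s) : loc :=
  cclass frac_cong (Frac a Ss).
Definition loc_can (a : A) : loc := frac a (ms1 S).

Lemma fracB a s (Ss : ms_set S s) b t (St : ms_set S t) :
  frac a Ss - frac b St = frac (a * t - b * s) (msM Ss St).
Proof.
rewrite /frac -cclass_sub; apply/cclass_eq; exists 1; split; first exact: ms1.
change (1 * ((a * t + - b * s) * (s * t) - (a * t - b * s) * (s * t)) = 0).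
ring.
Qed.

End Localization.

(* A homomorphism A -> B mapping S into T induces S^-1 A -> T^-1 B,
   a/s |-> phi(a)/phi(s). *)
Section LocalizationMap.
Context (A B : comPzRingType) (S : mulset A) (T : mulset B).
Context (phi : {rmorphism A -> B}).
Context (phiST : forall s, ms_set S s -> ms_set T (phi s)).

Definition loc_map (u : loc S) : loc T :=
  frac (phi (num (repr u))) (phiST (denP (repr u))).

Lemma loc_mapE a s (Ss : ms_set S s) :
  loc_map (frac a Ss) = frac (phi a) (phiST Ss).
Proof.
apply/cclass_eq.
have [t [St /= e]] : frac_rel (repr (frac a Ss)) (Frac a Ss)
  by exact: (cong_repr (frac_cong S)).
exists (phi t); split; first exact: phiST.
rewrite /num /den /= in e *.
by rewrite -!rmorphM -rmorphB -rmorphM e rmorph0.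
Qed.

Lemma loc_fracP (u : loc S) : exists a s (Ss : ms_set S s), u = frac a Ss.
Proof.
exists (num (repr u)), (den (repr u)), (denP (repr u)).
rewrite -[LHS](cclass_repr (C := frac_cong S)); congr cclass.
by apply: val_inj; exact: surjective_pairing.
Qed.

Lemma loc_map_zmod : zmod_morphism loc_map.
Proof.
move=> u v; have [a [s [Ss ->]]] := loc_fracP u.
have [b [t [St ->]]] := loc_fracP v.
rewrite fracB !loc_mapE fracB.
apply/cclass_eq; exists 1; split; first exact: ms1.
change (1 * (phi (a * t - b * s) * (phi s * phi t)
  - (phi a * phi t - phi b * phi s) * phi (s * t)) = 0).
by rewrite rmorphB !rmorphM; ring.
Qed.

End LocalizationMap.

Section LocalizationAtPrime.
Context (R : comPzRingType) (P : prime_ideal R).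

Lemma prime_compl1 : (~` P) 1. Proof. by case: (primeP P). Qed.
Lemma prime_complM s t : (~` P) s -> (~` P) t -> (~` P) (s * t).
Proof. by case: (primeP P) => _ _ h Ps Pt /h []. Qed.

Definition prime_compl := MulSet prime_compl1 prime_complM.

Definition loc_at : comPzRingType := loc prime_compl.

End LocalizationAtPrime.

(* The inverse limit of the A/J^n; its elements are represented by sequences
   (u_n) with u_(n+1) = u_n modulo J^n, the n-th component being the class of
   u_n in A/J^n. *)
Section Completion.
Context (A : comPzRingType) (J : set A).

Let J' n : ideal A := Ideal (ideal_pow_ideal J n).

Definition coherent :=
  {u : nat -> A | `[< forall n, ideal_pow J n (u n.+1 - u n) >]}.
HB.instance Definition _ := Choice.on coherent.
Definition Coherent u (h : forall n, ideal_pow J n (u n.+1 - u n)) : coherent :=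
  exist _ u (asboolT h).
Definition term (u : coherent) : nat -> A := val u.
Lemma termP u n : ideal_pow J n (term u n.+1 - term u n).
Proof. by have /asboolP := valP u; exact. Qed.

Lemma coherent_cst a n : ideal_pow J n (a - a).
Proof. by rewrite subrr; exact: (ideal0 (J' n)). Qed.

Lemma coherentN u n : ideal_pow J n (- term u n.+1 - - term u n).
Proof. by rewrite -opprD; apply: (@idealN _ (J' n)); exact: termP. Qed.

Lemma coherentD u v n :
  ideal_pow J n ((term u n.+1 + term v n.+1) - (term u n + term v n)).
Proof. by rewrite opprD addrACA; apply: (@idealD _ (J' n)); exact: termP. Qed.

Lemma coherentM u v n :
  ideal_pow J n (term u n.+1 * term v n.+1 - term u n * term v n).
Proof.
have -> : term u n.+1 * term v n.+1 - term u n * term v n =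
  term u n.+1 * (term v n.+1 - term v n) + term v n * (term u n.+1 - term u n)
  by ring.
by apply: (@idealD _ (J' n)); apply: (@idealM _ (J' n)); exact: termP.
Qed.

Definition coherent_cong : congruence coherent.
Proof.
apply: (@Congruence coherent
  (fun u v => forall n, ideal_pow J n (term u n - term v n))
  (Coherent (coherent_cst 0)) (fun u => Coherent (coherentN u))
  (fun u v => Coherent (coherentD u v))
  (Coherent (coherent_cst 1)) (fun u v => Coherent (coherentM u v))).
- by move=> x n; exact: coherent_cst.
- by move=> x y h n; rewrite -opprB; apply: (@idealN _ (J' n)); exact: h.
- move=> x y z h1 h2 n; rewrite -(subrKA (term y n)).
  by apply: (@idealD _ (J' n)).
- by move=> x y h n; rewrite /term /= -opprD; apply: (@idealN _ (J' n)); exact: h.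
- by move=> x y z h n; rewrite /term /= opprD addrACA subrr addr0; exact: h.
- move=> x y z h n; rewrite /term /= -mulrBl mulrC.
  by apply: (@idealM _ (J' n)); exact: h.
- by move=> x y z n; rewrite /term /= addrA; exact: coherent_cst.
- by move=> x y n; rewrite /term /= [X in _ - X]addrC; exact: coherent_cst.
- by move=> x n; rewrite /term /= add0r; exact: coherent_cst.
- by move=> x n; rewrite /term /= addNr; exact: coherent_cst.
- by move=> x y z n; rewrite /term /= mulrA; exact: coherent_cst.
- by move=> x y n; rewrite /term /= [X in _ - X]mulrC; exact: coherent_cst.
- by move=> x n; rewrite /term /= mul1r; exact: coherent_cst.
- by move=> x y z n; rewrite /term /= mulrDl; exact: coherent_cst.
Defined.

Definition completion : comPzRingType := cquot coherent_cong.
Definition compl_can (a : A) : completion :=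
  cclass coherent_cong (Coherent (coherent_cst a)).

End Completion.

(* A (x)_R B as formal sums of pairs (a, b), two sums being identified when all
   R-balanced biadditive maps into abelian groups agree on them. *)
Section Tensor.
Context (R A B : comPzRingType).
Context (phi : {rmorphism R -> A}) (psi : {rmorphism R -> B}).

Definition balanced (M : zmodType) (beta : A -> B -> M) :=
  [/\ forall a a' b, beta (a + a') b = beta a b + beta a' b,
      forall a b b', beta a (b + b') = beta a b + beta a b' &
      forall r a b, beta (phi r * a) b = beta a (psi r * b)].

Definition sum_along (M : zmodType) (beta : A -> B -> M) (s : seq (A * B)) :=
  \sum_(p <- s) beta p.1 p.2.

Definition tensor_rel (s t : seq (A * B)) :=
  forall (M : zmodType) (beta : A -> B -> M), balanced beta ->
  sum_along beta s = sum_along beta t.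

Definition tensor_opp (s : seq (A * B)) := [seq (- p.1, p.2) | p <- s].
Definition tensor_mul (s t : seq (A * B)) :=
  [seq (p.1 * q.1, p.2 * q.2) | p <- s, q <- t].

Lemma sum_along_cat (M : zmodType) (beta : A -> B -> M) s t :
  sum_along beta (s ++ t) = sum_along beta s + sum_along beta t.
Proof. exact: big_cat. Qed.

Lemma sum_along_opp (M : zmodType) (beta : A -> B -> M) s : balanced beta ->
  sum_along beta (tensor_opp s) = - sum_along beta s.
Proof.
case=> bl _ _; rewrite /sum_along big_map -sumrN; apply: eq_bigr => p _ /=.
have b0 b : beta 0 b = 0 by apply: (addrI (beta 0 b)); rewrite -bl !addr0.
by apply/eqP; rewrite -addr_eq0 -bl addNr b0.
Qed.

Lemma sum_along_mul (M : zmodType) (beta : A -> B -> M) s t :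
  sum_along beta (tensor_mul s t) =
  \sum_(p <- s) \sum_(q <- t) beta (p.1 * q.1) (p.2 * q.2).
Proof. by rewrite /sum_along big_allpairs_dep. Qed.

Definition tensor_cong : congruence (seq (A * B)).
Proof.
apply: (@Congruence _ tensor_rel
  [::] tensor_opp cat [:: (1, 1)] tensor_mul).
- by [].
- by move=> x y h M b hb; rewrite h.
- by move=> x y z h1 h2 M b hb; rewrite h1 ?h2.
- by move=> x y h M b hb; rewrite !sum_along_opp // h.
- by move=> x y z h M b hb; rewrite !sum_along_cat h.
- move=> x y z h M b hb; rewrite !sum_along_mul.
  apply: (h M (fun c d => \sum_(q <- z) b (c * q.1) (d * q.2))).
  case: hb => bl br bR; split=> [a a' c|a c c'|r a c].
  + by rewrite -big_split; apply: eq_bigr => q _; rewrite mulrDl bl.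
  + by rewrite -big_split; apply: eq_bigr => q _; rewrite mulrDl br.
  + by apply: eq_bigr => q _; rewrite -!mulrA bR.
- by move=> x y z M b hb; rewrite catA.
- by move=> x y M b hb; rewrite !sum_along_cat addrC.
- by [].
- move=> x M b hb; rewrite sum_along_cat sum_along_opp // addNr.
  by rewrite /sum_along big_nil.
- move=> x y z M b hb; rewrite !sum_along_mul big_allpairs_dep.
  apply: eq_bigr => p _; rewrite big_allpairs_dep; apply: eq_bigr => q _.
  by apply: eq_bigr => r _; rewrite !mulrA.
- move=> x y M b hb; rewrite !sum_along_mul exchange_big.
  apply: eq_bigr => p _; apply: eq_bigr => q _.
  by rewrite ![p.1 * _]mulrC ![p.2 * _]mulrC.
- move=> x M b hb; rewrite sum_along_mul big_seq1.
  by apply: eq_bigr => q _; rewrite !mul1r.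
- by move=> x y z M b hb; rewrite sum_along_cat !sum_along_mul big_cat.
Defined.

Definition tensor : comPzRingType := cquot tensor_cong.
Definition pure (a : A) (b : B) : tensor := cclass tensor_cong [:: (a, b)].

(* the structure map B -> A (x)_R B *)
Definition tensor_inr (b : B) : tensor := pure 1 b.

Lemma tensor_inr_zmod : zmod_morphism tensor_inr.
Proof.
move=> b c; rewrite /tensor_inr /pure -cclass_sub.
apply/cclass_eq => M beta hb /=; rewrite (sum_along_cat beta [:: (1, b)]).
rewrite (sum_along_opp [:: (1, c)] hb).
rewrite /sum_along !big_seq1 /=.
by case: hb => _ br _; apply/eqP; rewrite eq_sym subr_eq -br subrK.
Qed.

Lemma tensor_inr_monoid : monoid_morphism tensor_inr.
Proof.
split=> // b c; rewrite /tensor_inr /pure -cclass_mul /=.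
by rewrite /tensor_mul /= mulr1.
Qed.

HB.instance Definition _ :=
  GRing.isZmodMorphism.Build B tensor tensor_inr tensor_inr_zmod.
HB.instance Definition _ :=
  GRing.isMonoidMorphism.Build B tensor tensor_inr tensor_inr_monoid.

End Tensor.

(* The end of the Cech complex of A with respect to x_1, ..., x_d,
     \bigoplus_i A_(x_1 .. x_(i-1) x_(i+1) .. x_d) -> A_(x_1 .. x_d) -> 0,
   and its cokernel.  When x is a system of parameters of a d-dimensional
   Noetherian local ring (R, m), and A is an R-algebra in which x is replaced by
   its image, the cokernel is the top local cohomology H^d_m(A). *)
Section CechTop.
Context (A : comPzRingType) (d : nat) (x : 'I_d -> A).

(* Inverting the monomials in the x_j, j in J, is inverting their product; this
   choice makes all the maps of the complex of the form a/s |-> a/s. *)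
Definition monomials (J : {set 'I_d}) : set A :=
  [set s | exists e : 'I_d -> nat, s = \prod_(j in J) x j ^+ e j].

Lemma monomials1 J : monomials J 1.
Proof. by exists (fun=> 0%N); rewrite big1 // => j _; rewrite expr0. Qed.

Lemma monomialsM J s t : monomials J s -> monomials J t -> monomials J (s * t).
Proof.
move=> [e ->] [f ->]; exists (fun j => (e j + f j)%N).
by rewrite -big_split; apply: eq_bigr => j _; rewrite exprD.
Qed.

Definition monomial_ms J := MulSet (@monomials1 J) (@monomialsM J).

Definition cech (J : {set 'I_d}) : comPzRingType := loc (monomial_ms J).

Lemma monomialsT J s : monomials J s -> monomials [set: 'I_d] (idfun s).
Proof.
move=> [e ->]; exists (fun j => if j \in J then e j else 0%N).
rewrite big_mkcond /=; apply: eq_big => [j|j _]; first by rewrite inE.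
by case: ifP => // _; rewrite expr0.
Qed.

Definition cech_res J : cech J -> cech [set: 'I_d] :=
  loc_map (phi := idfun) (S := monomial_ms J) (T := monomial_ms [set: 'I_d])
    (@monomialsT J).

Lemma cech_res_zmod J : zmod_morphism (@cech_res J).
Proof. exact: loc_map_zmod. Qed.

Definition cech_diff (u : forall i : 'I_d, cech [set~ i]) : cech [set: 'I_d] :=
  \sum_(i < d) (-1) ^+ i * cech_res (u i).

Definition cech_boundary : {pred cech [set: 'I_d]} :=
  fun v => `[< exists u, v = cech_diff u >].

Lemma cech_boundary_zmod : zmod_closed cech_boundary.
Proof.
split.
  apply/asboolP; exists (fun=> 0); rewrite /cech_diff big1 // => i _.
  by have := cech_res_zmod (0 : cech [set~ i]) 0; rewrite !subrr => ->; rewrite mulr0.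
move=> v w /asboolP [u ->] /asboolP [u' ->]; apply/asboolP.
exists (fun i => u i - u' i); rewrite /cech_diff -sumrB; apply: eq_bigr => i _.
by rewrite cech_res_zmod mulrBr.
Qed.
HB.instance Definition _ :=
  GRing.isZmodClosed.Build (cech [set: 'I_d]) cech_boundary cech_boundary_zmod.

Definition cech_top : zmodType := Quotient.quot cech_boundary.

Lemma monomials_prod : monomials [set: 'I_d] (\prod_(i < d) x i).
Proof.
exists (fun=> 1%N); apply: eq_big => [j|j _]; [by rewrite inE | by rewrite expr1].
Qed.

(* the class of 1/(x_1 ... x_d) *)
Definition paraclass : cech_top :=
  \pi_cech_top (frac (S := monomial_ms [set: 'I_d]) 1 monomials_prod).

End CechTop.

Section CechMap.
Context (A B : comPzRingType) (phi : {rmorphism A -> B}) (d : nat).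
Context (x : 'I_d -> A).

Lemma monomials_map J s : monomials x J s -> monomials (phi \o x) J (phi s).
Proof.
move=> [e ->]; exists e; rewrite rmorph_prod.
by apply: eq_bigr => j _; rewrite rmorphXn.
Qed.

Definition cech_map J : cech x J -> cech (phi \o x) J :=
  loc_map (S := monomial_ms x J) (T := monomial_ms (phi \o x) J)
    (@monomials_map J).

Definition cech_top_map (c : cech_top x) : cech_top (phi \o x) :=
  \pi_(cech_top (phi \o x)) (cech_map (repr c)).

Lemma cech_map_zmod J : zmod_morphism (@cech_map J).
Proof. exact: loc_map_zmod. Qed.
HB.instance Definition _ J := GRing.isZmodMorphism.Build (cech x J)
  (cech (phi \o x) J) (@cech_map J) (@cech_map_zmod J).

Lemma cech_map_res J (u : cech x J) :
  cech_map (cech_res u) = cech_res (cech_map u).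
Proof.
have [a [s [Ss ->]]] := loc_fracP u.
by rewrite /cech_map /cech_res !loc_mapE; congr cclass; apply: val_inj.
Qed.

Lemma cech_map_sign J i (u : cech x J) :
  cech_map ((-1) ^+ i * u) = (-1) ^+ i * cech_map u.
Proof. elim: i => [|i IH] in u *; first by rewrite !expr0 !mul1r.
by rewrite !exprS -!mulrA !mulN1r -IH; exact: (raddfN (@cech_map J)). Qed.

Lemma cech_top_mapE (v : cech x [set: 'I_d]) :
  cech_top_map (\pi_(cech_top x) v) =
  \pi_(cech_top (phi \o x)) (cech_map v).
Proof.
rewrite /cech_top_map; apply/eqP; rewrite -Quotient.idealrBE -raddfB.
set w := _ - _.
have : w \in cech_boundary (x := x) by rewrite Quotient.idealrBE reprK.
move=> /asboolP [u ->]; apply/asboolP.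
exists (fun i => cech_map (u i)).
rewrite /cech_diff raddf_sum; apply: eq_bigr => i _.
by apply: (etrans (cech_map_sign _ _)); congr (_ * _); exact: cech_map_res.
Qed.

Lemma cech_top_map_paraclass :
  cech_top_map (paraclass x) = paraclass (phi \o x).
Proof.
rewrite /paraclass cech_top_mapE /cech_map loc_mapE; congr (\pi _).
apply/cclass_eq; exists 1; split; first exact: ms1.
by rewrite mul1r /num /den /= rmorph1 rmorph_prod subrr.
Qed.
End CechMap.

(* R is meant to be a Noetherian local ring; its maximal ideal m and its
   dimension d are then determined. *)
Definition parasolid (R A : comPzRingType) (phi : {rmorphism R -> A}) :=
  forall (m : set R) (d : nat) (x : 'I_d -> R),
    local_with m -> krull_dim R d -> parameters m x ->
    paraclass x != 0 -> cech_top_map phi (paraclass x) != 0.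

Definition universally_parasolid (R A : comPzRingType)
    (phi : {rmorphism R -> A}) :=
  forall (R' : comPzRingType) (psi : {rmorphism R -> R'}),
    noetherian_local R' -> parasolid (tensor_inr phi psi).

Section Forcing.
Context (S : comNzRingType) (f : seq S) (h : S).

Definition forcing_eq : {mpoly S[size f]} :=
  \sum_(i < size f) f`_i *: 'X_i + h%:MP.
Definition forcing_algebra : comPzRingType := iquot (gen [set forcing_eq]).
Definition forcing_map : {rmorphism S -> forcing_algebra} :=
  iproj (gen [set forcing_eq]) \o @mpolyC (size f) S.

Definition belongs_universally_parasolidly := universally_parasolid forcing_map.

End Forcing.

(* S is meant to be a complete Noetherian local domain; the result then does not
   depend on the choice of the generators f of I. *)
Definition parasolid_closure_domain (S : comNzRingType) (I : set S) : set S :=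
  [set h | exists f g : seq S,
     I = ideal_gen [set` f] /\
     let c := rcons g h in
     forall i, (i < size c)%N ->
       belongs_universally_parasolidly (f ++ take i c) c`_i].

Section Closure.
Context (R : comPzRingType) (m : prime_ideal R).

Definition compl_loc : comPzRingType :=
  completion (ideal_gen (@loc_can R (prime_compl m) @` m)).

Definition to_compl_loc (a : R) : compl_loc :=
  compl_can _ (@loc_can R (prime_compl m) a).

End Closure.

(* R is meant to be Noetherian. *)
Definition parasolid_closure (R : comPzRingType) (I : set R) : set R :=
  [set h | forall m : prime_ideal R, is_maximal m ->
     forall q : prime_ideal (compl_loc m), is_minimal_prime q ->
       let iota a := pproj q (to_compl_loc m a) in
       parasolid_closure_domain (ideal_gen (iota @` I)) (iota h)].

(* Main.v *)
(** Let x_1, ..., x_d generate the maximal ideal of the regular local ring R.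
    Hilbert functions, counted by initial exponents of monomials in x, drop by one
    degree along strict inclusions of primes; as R has a chain of d + 1 primes,
    there is no relation between the monomials.  This passes to the completion T
    of R, which is Noetherian by the division algorithm, a domain, of dimension d;
    so the only minimal prime of T is 0.

    Let Q_k = (x_1^(k+1), ..., x_d^(k+1)) in T and P = x_1 ... x_d.  The paraclass
    1/P dies in a T-algebra B iff P^k lies in Q_k B for some k, which does not
    happen for B = T.  The socle of T/Q_k is spanned by P^k, and ideals J
    containing Q_k satisfy Q_k : (Q_k : J) = J.  Hence if h is not in I, Krull's
    intersection theorem gives k with h not in J = I + Q_k, and duality gives u
    with u J in Q_k and u h = P^k modulo Q_k.  In the forcing algebra B of (I, h)
    over T one has h in I B, so P^k lies in Q_k B and B is not parasolid.  The
    ideal I is then recovered in R because it is closed.  Conversely, if h is in I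
    then the forcing algebra has a section over R, so it is universally
    parasolid. *)

From HB Require Import structures.
From mathcomp Require Import all_boot all_order all_algebra.
From mathcomp Require Import boolp classical_sets.
From mathcomp Require Import ring zify.
From mathcomp.multinomials Require Import mpoly.
Require Import Defs.

Set Implicit Arguments.
Unset Strict Implicit.
Unset Printing Implicit Defensive.

Import Order.TTheory GRing.Theory.
Local Open Scope classical_set_scope.
Local Open Scope ring_scope.

Identity Coercion set_pred : set >-> Funclass.

(** * Ideal arithmetic; Noetherian and local rings *)

Section IdealOps.
Context (R : comPzRingType).
Implicit Types (I J K L m : ideal R) (X : set R).

Lemma idealB I a b : I a -> I b -> I (a - b).
Proof. by move=> Ia Ib; apply: idealD => //; exact: idealN. Qed.

Lemma idealBl I a b : I (a - b) -> I b -> I a.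
Proof. by move=> Iab Ib; rewrite -(subrK b a); exact: idealD. Qed.

Lemma idealMr I a r : I a -> I (a * r).
Proof. by rewrite mulrC; exact: idealM. Qed.

Lemma ideal_sum I (A : Type) (s : seq A) (P : pred A) (F : A -> R) :
  (forall i, P i -> I (F i)) -> I (\sum_(i <- s | P i) F i).
Proof. by move=> h; elim/big_ind: _ => //; [exact: ideal0 | exact: idealD]. Qed.

Lemma mem_gen X a : X a -> ideal_gen X a.
Proof.
by move=> Xa; exists 1, (fun=> 1), (fun=> a); rewrite big_ord1 mul1r.
Qed.

Lemma gen_sub X I : X `<=` I -> ideal_gen X `<=` I.
Proof.
move=> XI a [n [c [y [Xy ->]]]]; apply: ideal_sum => i _.
by apply: idealM; apply: XI.
Qed.

Lemma genS X Y : X `<=` Y -> ideal_gen X `<=` ideal_gen Y.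
Proof.
by move=> XY; apply: (@gen_sub _ (gen Y)) => a /XY; exact: mem_gen.
Qed.

Lemma gen_rangeP n (f : 'I_n -> R) a :
  ideal_gen (range f) a <-> exists c : 'I_n -> R, a = \sum_(i < n) c i * f i.
Proof.
split=> [|[c ->]]; last first.
  by apply: (@ideal_sum (gen _)) => i _; apply: idealM; apply: mem_gen; exists i.
move=> [k [c [y [Xy ->]]]].
have /choice [t ht] : forall i, exists j, f j = y i.
  by move=> i; have [j _ <-] := Xy i; exists j.
exists (fun j => \sum_(i < k | t i == j) c i).
rewrite (partition_big t predT) //=; apply: eq_bigr => j _.
by rewrite mulr_suml; apply: eq_bigr => i /eqP <-; rewrite ht.
Qed.

Definition idl_add_set I J : set R :=
  [set a + b | a in ideal_set I & b in ideal_set J].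
Lemma idl_add_ideal I J : is_ideal (idl_add_set I J).
Proof.
split.
- by exists 0; [exact: ideal0|exists 0; [exact: ideal0|rewrite addr0]].
- move=> _ _ [a Ia [b Jb <-]] [a' Ia' [b' Jb' <-]].
  exists (a + a'); first exact: idealD.
  by exists (b + b'); [exact: idealD|rewrite addrACA].
- move=> r _ [a Ia [b Jb <-]]; exists (r * a); first exact: idealM.
  by exists (r * b); [exact: idealM|rewrite mulrDr].
Qed.
Definition idl_add I J : ideal R := Ideal (idl_add_ideal I J).

Lemma idl_addl I J a : I a -> idl_add I J a.
Proof. by move=> Ia; exists a => //; exists 0; [exact: ideal0|rewrite addr0]. Qed.
Lemma idl_addr I J a : J a -> idl_add I J a.
Proof. by move=> Ja; exists 0; [exact: ideal0|exists a => //; rewrite add0r]. Qed.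

Definition idl_addM_set I a J : set R :=
  [set b + a * c | b in ideal_set I & c in ideal_set J].
Lemma idl_addM_ideal I a J : is_ideal (idl_addM_set I a J).
Proof.
split.
- by exists 0; [exact: ideal0|exists 0; [exact: ideal0|rewrite mulr0 addr0]].
- move=> _ _ [b Ib [c Jc <-]] [b' Ib' [c' Jc' <-]].
  exists (b + b'); first exact: idealD.
  by exists (c + c'); [exact: idealD|rewrite mulrDr addrACA].
- move=> r _ [b Ib [c Jc <-]]; exists (r * b); first exact: idealM.
  by exists (r * c); [exact: idealM|rewrite mulrDr mulrCA].
Qed.
Definition idl_addM I a J : ideal R := Ideal (idl_addM_ideal I a J).

(** A zeroth power is the whole ring, so [idl_addM I a idl_full] is I + (a). *)
Definition idl_full : ideal R := Ideal (@ideal_pow_ideal R set0 0).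

Lemma idl_addMl I a J b : I b -> idl_addM I a J b.
Proof. by move=> Ib; exists b => //; exists 0; [exact: ideal0|rewrite mulr0 addr0]. Qed.
Lemma idl_addMr I a J b : J b -> idl_addM I a J (a * b).
Proof. by move=> Jb; exists 0; [exact: ideal0|exists b => //; rewrite add0r]. Qed.
Lemma idl_addM1 I a : idl_addM I a idl_full a.
Proof. by rewrite -[X in _ X](mulr1 a); apply: idl_addMr. Qed.

Lemma colon_ideal I X : is_ideal [set a | forall b, X b -> I (a * b)].
Proof.
split=> [b _|a a' ha ha' b Xb|r a ha b Xb].
- by rewrite mul0r; exact: ideal0.
- by rewrite mulrDl; apply: idealD; [exact: ha|exact: ha'].
- by rewrite -mulrA; apply: idealM; exact: ha.
Qed.
Definition colon I X : ideal R := Ideal (colon_ideal I X).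

Lemma zero_is_ideal : is_ideal [set 0 : R].
Proof. by split=> [|a b -> ->|r a ->] //=; rewrite ?addr0 ?mulr0. Qed.
Definition idl0 : ideal R := Ideal zero_is_ideal.

Definition idl_mul m X : ideal R := gen [set (a * b : R) | a in ideal_set m & b in X].

Section Noetherian.
Hypothesis noethR : noetherian R.

Lemma noetherian_gen I : exists n (f : 'I_n -> R), ideal_set I = ideal_gen (range f).
Proof. by apply: noethR; exact: idealP. Qed.

(** Without a maximal member, choice builds a strictly increasing sequence in [F]; its union is
    finitely generated, hence reached at a finite stage. *)
Lemma noetherian_max (F : ideal R -> Prop) I0 : F I0 ->
  exists I, F I /\ forall J, F J -> I `<=` J -> J `<=` I.
Proof.
move=> FI0; apply: contrapT => /forallNP noMax.
have /choice [next hnext] : forall I : {I | F I}, exists J : {J | F J},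
    sval I `<=` sval J /\ ~ (sval J `<=` sval I).
  move=> [I FI]; have /not_andP [//|/existsNP [J]] := noMax I.
  by move=> /not_implyP [FJ /not_implyP [IJ JI]]; exists (exist _ J FJ).
pose s n := sval (iter n next (exist _ I0 FI0)).
have sS n : s n `<=` s n.+1 by have [] := hnext (iter n next (exist _ I0 FI0)).
have smono k n : (k <= n)%N -> s k `<=` s n.
  elim: n => [|n IH]; first by rewrite leqn0 => /eqP ->.
  by rewrite leq_eqVlt => /orP[/eqP -> //|/IH h]; apply: subset_trans h (sS n).
have Ui : is_ideal [set a | exists n, s n a].
  split=> [|a b [n sa] [k sb]|r a [n sa]].
  - by exists 0; exact: ideal0.
  - exists (maxn n k); apply: idealD.
      by apply: smono sa; exact: leq_maxl.
    by apply: smono sb; exact: leq_maxr.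
  - by exists n; exact: idealM.
have [n [f Uf]] := noethR Ui.
have /choice [t ht] : forall i, exists k, s k (f i).
  move=> i; have : [set a | exists n, s n a] (f i) by rewrite Uf; apply: mem_gen; exists i.
  by [].
pose N := (\max_(i < n) t i)%N.
have [_ []] := hnext (iter N next (exist _ I0 FI0)).
move=> a sa; have : [set a | exists n, s n a] a by exists N.+1.
rewrite Uf; apply: gen_sub => _ [i _ <-]; apply: smono (ht i).
exact: (leq_bigmax i).
Qed.

End Noetherian.

(** Locality in terms of units, the form used in the proofs; [local_with_units] and
    [units_local_with] connect it with uniqueness of the maximal ideal. *)
Record is_local m := IsLocal {
  localU : forall a, ~ m a -> exists b, a * b = 1;
  local1 : ~ m 1
}.

Section Local.
Context (m : ideal R) (locR : is_local m).

Lemma local_proper I : ~ I 1 -> I `<=` m.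
Proof.
move=> I1 a Ia; apply: contrapT => /(localU locR) [b ab].
by apply: I1; rewrite -ab; exact: idealMr.
Qed.

Lemma local_1B a : m a -> exists b, (1 - a) * b = 1.
Proof.
move=> ma; apply: (localU locR) => h; apply: (local1 locR).
by rewrite -(subrK a 1); exact: idealD.
Qed.

(** Induction on the number of generators: as 1 - c is a unit for c in [m], the last generator can
    be solved for modulo [I] in terms of the others, with coefficients in [m], and eliminated. *)
Lemma nakayama I n (f : 'I_n -> R) :
  (forall i, idl_add I (idl_mul m (range f)) (f i)) ->
  forall i, I (f i).
Proof.
elim: n f => [|n IH] f hf; first by case.
have main : I (f ord_max) -> forall i, I (f i).
  move=> Imax.
  suff h : forall i : 'I_n, I (f (widen_ord (leqnSn n) i)).
    move=> i; have [k ->|->] := unliftP ord_max i; last by [].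
    have -> : lift ord_max k = widen_ord (leqnSn n) k.
      by apply: val_inj => /=; rewrite /bump leqNgt ltn_ord.
    exact: h.
  apply: (IH (fun i => f (widen_ord (leqnSn n) i))) => i.
  have [a Ia [b mb <-]] := hf (widen_ord (leqnSn n) i).
  apply: idealD; first exact: idl_addl.
  move: b mb; apply: gen_sub => _ [r mr [_ [j _ <-] <-]].
  have [k ->|->] := unliftP ord_max j; last by apply: idl_addl; exact: idealM.
  have -> : lift ord_max k = widen_ord (leqnSn n) k.
    by apply: val_inj => /=; rewrite /bump leqNgt ltn_ord.
  apply: idl_addr; apply: mem_gen; exists r => //.
  by exists (f (widen_ord (leqnSn n) k)) => //; exists k.
pose g := fun i : 'I_n => f (widen_ord (leqnSn n) i).
pose J := idl_add I (gen (range g)).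
have hsplit b : idl_mul m (range f) b ->
    idl_addM (idl_mul m (range g)) (f ord_max) m b.
  apply: gen_sub => _ [r mr [_ [j _ <-] <-]].
  have [k ->|->] := unliftP ord_max j; last by rewrite mulrC; apply: idl_addMr.
  have -> : lift ord_max k = widen_ord (leqnSn n) k.
    by apply: val_inj => /=; rewrite /bump leqNgt ltn_ord.
  apply: idl_addMl; apply: mem_gen; exists r => //.
  by exists (g k) => //; exists k.
pose mg := idl_mul m (range g).
have hmax : idl_add I mg (f ord_max).
  have [a Ia [_ /hsplit [b mb [c mc <-]] e]] := hf ord_max.
  have [u hu] := local_1B mc.
  have -> : f ord_max = u * (a + b).
    rewrite -[LHS]mulr1 -hu mulrA [RHS]mulrC; congr (_ * _).
    by rewrite mulrBr mulr1 -{1}e; ring.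
  by apply: idealM; exists a => //; exists b.
apply: main.
suff hg : forall i, I (g i).
  have [a Ia [b mb <-]] := hmax; apply: idealD => //.
  by move: b mb; apply: gen_sub => _ [r mr [_ [j _ <-] <-]]; apply: idealM.
apply: IH => i.
have [a Ia [_ /hsplit [b mb [c mc <-]] e]] := hf (widen_ord (leqnSn n) i).
rewrite /g -e; apply: idealD; first exact: idl_addl.
apply: idealD; first exact: idl_addr.
by apply: idealMr.
Qed.

End Local.

End IdealOps.

(** * Filtrations by monomials *)

Section Rank.
Context (d : nat).
Implicit Types (a b c : 'X_{1..d}).

(* A strictly increasing map from the degree-lexicographic order to [nat]: the
   filtration [G] below can then be treated by induction on [nat]. *)
Definition rk a : nat :=
  #|[set b : 'X_{1..d < (mdeg a).+1} | (bmnm b < a)%O]%SET|.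

(** Exponents below [a] have at most its degree, so any larger truncation gives the same count;
    ranks can thus be compared inside one finite type. *)
Lemma rkE a k : (mdeg a < k)%N ->
  rk a = #|[set b : 'X_{1..d < k} | (bmnm b < a)%O]%SET|.
Proof.
move=> ak; have wP (b : 'X_{1..d < (mdeg a).+1}) : (mdeg b < k)%N.
  exact: leq_trans (bmdeg b) ak.
pose w t := BMultinom (wP t).
have w_inj : injective w by move=> s t [] /val_inj.
rewrite /rk -(card_imset _ w_inj); apply: eq_card => b; rewrite !inE.
apply/imsetP/idP => [[c]|ba]; first by rewrite inE => h ->.
have bP : (mdeg b < (mdeg a).+1)%N by rewrite ltnS; apply/lemc_mdeg/ltW.
by exists (BMultinom bP); [rewrite inE|apply: val_inj].
Qed.

Lemma rk_bound a k : (mdeg a < k)%N -> (rk a < #|{: 'X_{1..d < k}}|)%N.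
Proof.
move=> ak; rewrite (rkE ak) -cardsT; apply: proper_card.
apply/properP; split; first exact: finset.subsetT.
by exists (BMultinom ak); rewrite !inE // ltxx.
Qed.

Lemma rk_lt_mono a b : (a < b)%O -> (rk a < rk b)%N.
Proof.
move=> ab; have ak : (mdeg a < (mdeg b).+1)%N.
  by rewrite ltnS; apply/lemc_mdeg/ltW.
rewrite (rkE ak) (rkE (ltnSn (mdeg b))); apply: proper_card.
apply/properP; split.
  by apply/fintype.subsetP => c; rewrite !inE => /lt_trans; apply.
by exists (BMultinom ak); rewrite !inE ?ltxx.
Qed.

Lemma rk_lt a b : (rk a < rk b)%N = (a < b)%O.
Proof.
apply/idP/idP => [|/rk_lt_mono //].
by case: ltgtP => // [/rk_lt_mono|->]; rewrite ?ltnn // => /ltnW; rewrite leqNgt => /negP.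
Qed.

Lemma rk_le a b : (rk a <= rk b)%N = (a <= b)%O.
Proof. by rewrite leqNgt rk_lt -leNgt. Qed.

Lemma rk_inj : injective rk.
Proof. by move=> a b e; apply/eqP; rewrite eq_le -!rk_le e leqnn. Qed.

Lemma rk_mdeg k a : (#|{: 'X_{1..d < k}}| <= rk a)%N -> (k <= mdeg a)%N.
Proof. by apply: contraTT; rewrite -!ltnNge => /rk_bound. Qed.

Lemma mdeg_rk a b : (mdeg a < mdeg b)%N -> (rk a < rk b)%N.
Proof. by move=> ab; rewrite rk_lt; exact: lt_mdeg_ltmc. Qed.

End Rank.

Section Monomial.
Context (T : comPzRingType) (d : nat) (x : 'I_d -> T).
Implicit Types (a b : 'X_{1..d}) (U V : set 'X_{1..d}) (J L : ideal T).

Definition mon a : T := \prod_(i < d) x i ^+ a i.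

Lemma mon0 : mon 0%MM = 1.
Proof. by rewrite /mon big1 // => i _; rewrite mnm0E expr0. Qed.

Lemma monD a b : mon (a + b)%MM = mon a * mon b.
Proof. by rewrite /mon -big_split; apply: eq_bigr => i _; rewrite mnmDE exprD. Qed.

Lemma monU i : mon U_(i)%MM = x i.
Proof.
rewrite /mon (bigD1 i) //= mnm1E eqxx expr1 big1 ?mulr1 // => j ij.
by rewrite mnm1E eq_sym (negPf ij) expr0.
Qed.

Lemma monUn i n : mon (U_(i) *+ n)%MM = x i ^+ n.
Proof.
elim: n => [|n IH]; first by rewrite mulm0n mon0 expr0.
by rewrite mulmS monD IH monU exprS.
Qed.

Definition mono U : ideal T := gen (mon @` U).

Lemma mem_mono U a : U a -> mono U (mon a).
Proof. by move=> Ua; apply: mem_gen; exists a. Qed.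

Lemma mono_sub U J : (forall a, U a -> J (mon a)) -> mono U `<=` J.
Proof. by move=> h; apply: gen_sub => _ [a Ua <-]; exact: h. Qed.

Lemma monoS U V : U `<=` V -> mono U `<=` mono V.
Proof. by move=> UV; apply: mono_sub => a /UV; exact: mem_mono. Qed.

(** With one factor fixed, the condition on the other one defines a colon ideal, so it can be
    checked on generators, one factor at a time. *)
Lemma mono_mul U V W u v : (forall a b, U a -> V b -> W (a + b)%MM) ->
  mono U u -> mono V v -> mono W (u * v).
Proof.
move=> h Uu Vv.
suff : colon (mono W) (mono V) u by apply.
move: u Uu; apply: mono_sub => a Ua w Vw.
suff : colon (mono W) [set mon a] w by rewrite mulrC; apply.
move: w Vw; apply: mono_sub => b Vb _ ->.
by rewrite mulrC -monD; apply: mem_mono; exact: h.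
Qed.

(* [M k] is the k-th power of the ideal generated by [x]; [G] refines [M] to a
   filtration in which each step adds at most one monomial. *)
Definition M k := mono [set a | (k <= mdeg a)%N].
Definition G n := mono [set a | (n <= rk a)%N].

Lemma G_le k l u : (k <= l)%N -> G l u -> G k u.
Proof. by move=> kl; move: u; apply: monoS => a /=; exact: leq_trans. Qed.

Lemma M0 u : M 0 u.
Proof. by rewrite -[u]mulr1 -mon0; apply: idealM; exact: mem_mono. Qed.

Lemma G0 u : G 0 u.
Proof. by rewrite -[u]mulr1 -mon0; apply: idealM; exact: mem_mono. Qed.

Lemma M_mul k l u v : M k u -> M l v -> M (k + l) (u * v).
Proof. by apply: mono_mul => a b /= ka lb; rewrite mdegD leq_add. Qed.

Lemma M1_x i : M 1 (x i).
Proof. by rewrite -monU; apply: mem_mono; rewrite /= mdeg1. Qed.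

Lemma M1_gen : ideal_set (M 1) = ideal_gen (range x).
Proof.
apply/seteqP; split; last first.
  by apply: gen_sub => _ [i _ <-]; exact: M1_x.
apply: (@mono_sub _ (gen _)) => a /=; rewrite mdegE => h.
have /existsP [i ai] : [exists i, a i != 0%N].
  apply: contraTT h; rewrite negb_exists -leqNgt => /forallP h.
  by rewrite big1 // => i _; apply/eqP; have := h i; rewrite negbK.
have /submK <- : (U_(i) <= a)%MM by rewrite lep1mP.
by rewrite monD monU; apply: (@idealM _ (gen _)); apply: mem_gen; exists i.
Qed.

Lemma M_G k n u : (forall a, (k <= mdeg a)%N -> (n <= rk a)%N) -> M k u -> G n u.
Proof. by move=> h; move: u; apply: monoS => a /=; exact: h. Qed.

Lemma M_Grk k a u : (mdeg a < k)%N -> M k u -> G (rk a).+1 u.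
Proof. by move=> ak; apply: M_G => b kb; apply/mdeg_rk/leq_trans/kb. Qed.

Lemma G_M k u : G #|{: 'X_{1..d < k}}| u -> M k u.
Proof. by move: u; apply: monoS => a /=; exact: rk_mdeg. Qed.

Lemma G_mon a : G (rk a) (mon a).
Proof. by apply: mem_mono => /=. Qed.

Lemma G_mulS a b u v : G (rk a).+1 u -> G (rk b) v -> G (rk (a + b)%MM).+1 (u * v).
Proof.
by apply: mono_mul => a' b' /=; rewrite !rk_lt !rk_le; exact: ltmc_le_add.
Qed.

Lemma G_M1 a c u : M 1 c -> G (rk a) u -> G (rk a).+1 (c * u).
Proof.
apply: mono_mul => b b' /= b1; rewrite !rk_lt !rk_le => /le_lt_trans; apply.
by rewrite -rk_lt; apply: mdeg_rk; rewrite mdegD -[ltnLHS]add0n ltn_add2r.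
Qed.

(** At most one exponent has rank [n], since [rk] is injective; hence a single monomial separates
    two successive steps. The restriction to [V] serves [mono_G]. *)
Lemma mono_split V n u : mono (V `&` [set a | (n <= rk a)%N]) u ->
  mono (V `&` [set a | (n.+1 <= rk a)%N]) u \/
  exists a c, [/\ rk a = n, V a & mono (V `&` [set a | (n.+1 <= rk a)%N]) (u - c * mon a)].
Proof.
have [[a [an Va]] Gu|noa Gu] := pselect (exists a, rk a = n /\ V a).
  right.
  have : idl_addM (mono (V `&` [set a | (n.+1 <= rk a)%N])) (mon a) (idl_full T) u.
    move: u Gu; apply: mono_sub => b [Vb /=].
    rewrite leq_eqVlt => /orP[/eqP e|h]; last by apply: idl_addMl; exact: mem_mono.
    have -> : b = a by apply: rk_inj; rewrite -e.
    exact: idl_addM1.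
  move=> [v Gv [c _ <-]]; exists a, c; split=> //.
  by rewrite [mon a * c]mulrC addrK.
left; move: u Gu; apply: monoS => a [Va /=]; rewrite leq_eqVlt => /orP[/eqP e|//].
by case: noa; exists a.
Qed.

Lemma G_split n u : G n u -> G n.+1 u \/
  exists a c, rk a = n /\ G n.+1 (u - c * mon a).
Proof.
rewrite /G -(setTI [set a | (n <= rk a)%N]) -(setTI [set a | (n.+1 <= rk a)%N]).
case/mono_split=> [|[a [c [an _ h]]]]; first by left.
by right; exists a, c.
Qed.

(* The exponents of the leading monomials of [J] for the local order, in which
   the smallest monomial leads. *)
Definition inits J : set 'X_{1..d} :=
  [set a | exists j, J j /\ G (rk a).+1 (j - mon a)].

Lemma initsS J L : J `<=` L -> inits J `<=` inits L.
Proof. by move=> JL a [j [/JL Lj h]]; exists j. Qed.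

Lemma inits_up J a b : inits J a -> inits J (a + b)%MM.
Proof.
move=> [j [Jj h]]; exists (j * mon b); split; first exact: idealMr.
by rewrite monD -mulrBl; apply: G_mulS => //; exact: G_mon.
Qed.

Lemma inits_M J k a : M k `<=` J -> (k <= mdeg a)%N -> inits J a.
Proof.
move=> MJ ka; exists (mon a); split; last by rewrite subrr; exact: ideal0.
by apply: MJ; exact: mem_mono.
Qed.

Lemma inits_addM J k a : (mdeg a < k)%N -> inits (idl_add J (M k)) a -> inits J a.
Proof.
move=> ak [_ [[j Jj [u Mu <-]] h]]; exists j; split=> //.
rewrite -(addrK u j) addrAC; apply: idealB => //.
exact: M_Grk Mu.
Qed.

Section LocalMonomial.
Hypothesis locT : is_local (M 1).

(** A coefficient in the maximal ideal only contributes to the next step, so a leading coefficient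
    may be taken to be a unit. *)
Lemma lead n u : G n u -> G n.+1 u \/
  exists a c, [/\ rk a = n, ~ M 1 c & G n.+1 (u - c * mon a)].
Proof.
case/G_split => [|[a [c [an h]]]]; [by left|].
have [Mc|Mc] := pselect (M 1 c); last by right; exists a, c.
left; rewrite -(subrK (c * mon a) u); apply: idealD => //.
by rewrite -an; apply: G_M1 => //; exact: G_mon.
Qed.

Lemma lead_in J n u : J u -> G n u -> G n.+1 u \/
  exists a c, [/\ rk a = n, inits J a & G n.+1 (u - c * mon a)].
Proof.
move=> Ju /lead [|[a [c [an Mc h]]]]; first by left.
right; exists a, c; split=> //.
have [e ce] := localU locT Mc.
exists (e * u); split; first exact: idealM.
rewrite an (_ : _ - _ = e * (u - c * mon a)); first exact: idealM.
by rewrite mulrBr mulrA [e * c]mulrC ce mul1r.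
Qed.

(** The standard basis argument: the successive leading terms of [u] are cancelled by elements of
    [J]. The remainder stays in [L], and it ends in [M k], which is contained in [J]. *)
Lemma inits_sub J L k : J `<=` L -> M k `<=` J ->
  (forall a, inits L a -> inits J a) -> L `<=` J.
Proof.
move=> JL MJ h u Lu.
suff hn n : idl_add J (G n) u.
  have [j Jj [v /G_M/MJ Jv <-]] := hn #|{: 'X_{1..d < k}}|.
  exact: idealD.
elim: n => [|n [j Jj [v Gv e]]]; first by apply: idl_addr; exact: G0.
have Lv : L v by apply: (@idealBl _ _ _ (- j)); [rewrite opprK addrC e|apply/idealN/JL].
have [Gv'|[a [c [an /h [w [Jw hw]] Gva]]]] := lead_in Lv Gv.
  by rewrite -e; exists j => //; exists v.
exists (j + c * w); first by apply: idealD => //; exact: idealM.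
exists (v - c * w); last by rewrite -e; ring.
rewrite an in hw.
rewrite (_ : v - c * w = (v - c * mon a) - c * (w - mon a)); last by ring.
by apply: idealB => //; exact: idealM.
Qed.

Section Krull.
Hypothesis noethT : noetherian T.

Lemma krull_set_ideal J : is_ideal [set u | forall k, idl_add J (M k) u].
Proof.
by split=> [k|u v hu hv k|r u hu k]; [exact: ideal0|exact: idealD|exact: idealM].
Qed.

(* Herstein's argument: an ideal [L] maximal with [L /\ K = J + m K], where [K] is
   the intersection, contains a power of each [x i], hence a power of [m]. *)
Lemma krull_intersection J u : (forall k, idl_add J (M k) u) -> J u.
Proof.
pose K : ideal T := Ideal (krull_set_ideal J); move=> Ku.
have {Ku} : K u by [].
have JK : J `<=` K by move=> v Jv k; exact: idl_addl.
pose JmK := idl_add J (idl_mul (M 1) K).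
have JmKK : JmK `<=` K.
  move=> _ [v Jv [w Kw <-]]; apply: idealD; first exact: JK.
  by move: w Kw; apply: gen_sub => _ [r _ [k Kk <-]]; exact: idealM.
have [] := @noetherian_max _ noethT
  (fun L => JmK `<=` L /\ forall v, L v -> K v -> JmK v) JmK; first by split.
move=> L [[JL LK] Lmax].
have xL i : exists n, L (x i ^+ n).
  have [] := @noetherian_max _ noethT
    (fun I => exists n, I = colon L [set x i ^+ n]) (colon L [set x i ^+ 0%N]).
    by exists 0%N.
  move=> I [[n ->] Imax]; exists n.
  have stab r : L (r * x i ^+ n.+1) -> L (r * x i ^+ n).
    move=> h; apply: (Imax (colon L [set x i ^+ n.+1])) => //; first by exists n.+1.
      move=> s hs _ ->; rewrite exprSr mulrA; apply: idealMr; exact: hs.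
    by move=> _ ->.
  (* By maximality it suffices that L + (x_i^n) still meets [K] inside [JmK]. If v = l + x_i^n r
     lies in [K], then x_i v lies in m K, so x_i^(n+1) r lies in [L], and [stab] puts x_i^n r in
     [L]. *)
  apply: (Lmax (idl_addM L (x i ^+ n) (idl_full T))); last exact: idl_addM1.
  - split; first by move=> v /JL Lv; exact: idl_addMl.
    move=> v [l Ll [r _ e]] Kv; apply: (LK) => //.
    rewrite -e; apply: idealD => //; rewrite mulrC; apply: stab.
    rewrite (_ : r * x i ^+ n.+1 = x i * v - x i * l); last first.
      by rewrite -e exprS; ring.
    apply: idealB; last exact: idealM.
    apply: JL; apply: idl_addr; apply: mem_gen.
    by exists (x i); [exact: M1_x|exists v].
  - by move=> v Lv; exact: idl_addMl.
have /choice [n hn] := xL.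
have ML : M (\sum_i n i).+1 `<=` L.
  apply: mono_sub => a /=; rewrite mdegE => h.
  (* Pigeonhole: the degree of [a] exceeds the sum of all the bounds. *)
  have /existsP [i ai] : [exists i, (n i <= a i)%N].
    apply: contraTT h; rewrite negb_exists -leqNgt => /forallP h.
    by apply: leq_sum => i _; apply: ltnW; rewrite ltnNge.
  rewrite /mon (bigD1 i) //= -(subnKC ai) exprD -mulrA; apply: idealMr; exact: hn.
have KJ : K `<=` JmK.
  move=> v Kv; apply: LK => //.
  have [j Jj [w /ML Lw <-]] := Kv (\sum_i n i).+1.
  by apply: idealD => //; apply: JL; exact: idl_addl.
have [r [f Kf]] := noetherian_gen noethT K.
suff : forall i, J (f i).
  move=> Jf; rewrite Kf; apply: gen_sub => _ [i _ <-]; exact: Jf.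
apply: (nakayama locT) => i.
have /KJ [j Jj [w Kw <-]] : K (f i) by rewrite Kf; apply: mem_gen; exists i.
exists j => //; exists w => //.
move: w Kw; apply: gen_sub => _ [s ms [v Kv <-]].
move: v Kv; rewrite Kf => v /gen_rangeP [e ->].
rewrite mulr_sumr; apply: ideal_sum => k _; rewrite mulrCA; apply: idealM.
by apply: mem_gen; exists s => //; exists (f k) => //; exists k.
Qed.

End Krull.
End LocalMonomial.
End Monomial.

(** * Division by finitely many elements of an ideal *)

Section Dickson.

Lemma tail_min (f : nat -> nat) n :
  exists k, (n <= k)%N /\ forall l, (n <= l)%N -> (f k <= f l)%N.
Proof.
have : exists v, `[< exists k, (n <= k)%N /\ f k = v >].
  by exists (f n); apply/asboolP; exists n.
move=> /ex_minnP [_ /asboolP [k [nk <-]] hmin]; exists k; split=> // l nl.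
by apply: hmin; apply/asboolP; exists l.
Qed.

(** Each new index is the position of a minimum of [f] on the tail after the previous index, so its
    value bounds all later ones from below. *)
Lemma nondecreasing_subseq (f : nat -> nat) : exists s : nat -> nat,
  {homo s : i j / (i < j)%N} /\ {homo (f \o s) : i j / (i <= j)%N}.
Proof.
have /choice [t ht] := tail_min f.
pose s := fix s i := if i is j.+1 then t (s j).+1 else t 0%N.
have sS i : (s i < s i.+1)%N by have [] := ht (s i).+1.
have smono : {homo s : i j / (i < j)%N} by apply: homo_ltn => // ? ? ?; exact: ltn_trans.
exists s; split=> // i j; rewrite leq_eqVlt => /orP[/eqP -> //|ij] /=.
case: i ij => [|i] ij; first by have [_] := ht 0%N; apply.
have [_ h] := ht (s i).+1; apply: h.
by apply/(leq_trans (sS i))/ltnW/smono.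
Qed.

Context (d : nat).
Implicit Types (a b : 'X_{1..d}).

Lemma nondecreasing_subseq_mnm (f : nat -> 'X_{1..d}) : exists s : nat -> nat,
  {homo s : i j / (i < j)%N} /\ forall i j, (i <= j)%N -> (f (s i) <= f (s j))%MM.
Proof.
suff h k : (k <= d)%N -> exists s : nat -> nat, {homo s : i j / (i < j)%N} /\
    forall i j, (i <= j)%N -> forall l : 'I_d, (l < k)%N -> (f (s i) l <= f (s j) l)%N.
  have [s [smono hs]] := h d (leqnn d); exists s; split=> // i j ij.
  by apply/mnm_lepP => l; exact: hs.
elim: k => [|k IH] kd; first by exists id; split.
have [s [smono hs]] := IH (ltnW kd).
have [t [tmono ht]] := nondecreasing_subseq (fun i => f (s i) (Ordinal kd)).
exists (s \o t); split=> [i j ij|i j ij l].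
  by apply/smono/tmono.
have ij' : (t i <= t j)%N by move: ij; rewrite leq_eqVlt => /orP[/eqP -> //|/tmono /ltnW].
rewrite ltnS leq_eqVlt => /orP[/eqP lk|]; last exact: hs.
by rewrite (_ : l = Ordinal kd); [exact: ht|exact: val_inj].
Qed.

(** Otherwise elements of [U] above none of their predecessors could be chosen forever, against the
    existence of a nondecreasing subsequence. *)
Lemma dickson (U : set 'X_{1..d}) : exists s : seq 'X_{1..d},
  {in s, forall b, U b} /\ forall a, U a -> exists2 b, b \in s & (b <= a)%MM.
Proof.
apply: contrapT => /forallNP noBasis.
have /choice [next hnext] : forall s : seq 'X_{1..d}, exists a,
    {in s, forall b, U b} -> U a /\ {in s, forall b, ~~ (b <= a)%MM}.
  move=> s; have [sU|nsU] := pselect {in s, forall b, U b}; last by exists 0%MM.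
  have := noBasis s; move=> /not_andP [//|/existsNP [a /not_implyP [Ua ha]]].
  by exists a => _; split=> // b bs; apply/negP => ba; apply: ha; exists b.
pose s := fix s n := if n is k.+1 then next (s k) :: s k else [::].
have sU n : {in s n, forall b, U b}.
  elim: n => [//|n IH] b /=; rewrite inE => /orP[/eqP -> |/IH //].
  by have [] := hnext _ IH.
have smem i n : (i < n)%N -> next (s i) \in s n.
  elim: n => // n IH; rewrite ltnS leq_eqVlt inE => /orP[/eqP ->|/IH ->]; by rewrite ?eqxx ?orbT.
have [t [tmono ht]] := nondecreasing_subseq_mnm (fun n => next (s n)).
have [_ h] := hnext _ (sU (t 1%N)).
by have := h _ (smem (t 0%N) (t 1%N) (tmono _ _ (ltnSn 0))); rewrite ht.
Qed.

End Dickson.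

(** * Division algorithm, Artin-Rees lemma and the drop of Hilbert functions *)

Section Division.
Context (T : comPzRingType) (d : nat) (x : 'I_d -> T).
Implicit Types (a b : 'X_{1..d}) (J L P : ideal T).
Local Notation M := (M x).
Local Notation G := (G x).
Hypothesis locT : is_local (M 1).

(** Degree is compared first, so the exponents of degree less than [k] fill an initial segment of
    the ranks; hence [M k] is one of the steps of [G]. *)
Lemma rk_mdegE k a : (#|{: 'X_{1..d < k}}| <= rk a)%N = (k <= mdeg a)%N.
Proof.
apply/idP/idP => [/rk_mdeg //|ka].
have ka' : (k <= (mdeg a).+1)%N by exact: leqW.
have wP (t : 'X_{1..d < k}) : (mdeg t < (mdeg a).+1)%N.
  exact: leq_trans (bmdeg t) ka'.
pose w t := BMultinom (wP t).
have w_inj : injective w by move=> s t [] /val_inj.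
rewrite -cardsT -(card_imset _ w_inj); apply: subset_leq_card.
apply/fintype.subsetP => _ /imsetP [t _ ->]; rewrite inE /=.
by apply: lt_mdeg_ltmc; exact: leq_trans (bmdeg t) ka.
Qed.

Lemma M_GE k u : M k u <-> G #|{: 'X_{1..d < k}}| u.
Proof.
split; last exact: G_M.
by apply: M_G => a; rewrite rk_mdegE.
Qed.

(** The divisors have as leading exponents a Dickson basis of [inits x J], and [C] is the largest
    degree among these. Cancelling a leading monomial of degree at least [k] costs at most [C],
    uniformly in [u] and in the precision [N]. *)
Lemma division J : exists r (j : 'I_r -> T) C, (forall i, J (j i)) /\
  forall k N u, J u -> M k u -> exists g : 'I_r -> T,
    (forall i, M (k - C) (g i)) /\ M N (u - \sum_i g i * j i).
Proof.
have [s [sU hs]] := dickson (inits x J).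
have /choice [j hj] : forall i : 'I_(size s), exists j,
    J j /\ G (rk (nth 0%MM s i)).+1 (j - mon x (nth 0%MM s i)).
  by move=> i; apply: sU; apply: mem_nth.
exists (size s), j, (\max_(i < size s) mdeg (nth 0%MM s i))%N; split.
  by move=> i; have [] := hj i.
set C := (\max_(i < _) _)%N => k N u Ju Mu.
suff h n : exists g : 'I_(size s) -> T,
    (forall i, M (k - C) (g i)) /\ G (#|{: 'X_{1..d < k}}| + n) (u - \sum_i g i * j i).
  have [g [Mg Gg]] := h #|{: 'X_{1..d < N}}|; exists g; split=> //.
  by apply/M_GE; apply: G_le Gg; exact: leq_addl.
elim: n => [|n [g [Mg Gg]]].
  exists (fun=> 0); split=> [i|]; first exact: ideal0.
  by rewrite addn0 big1 ?subr0; [exact/M_GE|move=> i _; rewrite mul0r].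
have Jw : J (u - \sum_i g i * j i).
  by apply: idealB => //; apply: ideal_sum => i _; apply: idealM; have [] := hj i.
rewrite addnS; have [h|[a [c [an /hs [b bs ba] Ga]]]] := lead_in locT Jw Gg.
  by exists g.
have ib : (index b s < size s)%N by rewrite index_mem.
pose i0 := Ordinal ib.
have bE : nth 0%MM s i0 = b by rewrite nth_index.
exists (fun i => g i + (if i == i0 then c * mon x (a - b)%MM else 0)); split.
  move=> i; apply: idealD => //; case: eqP => [_|_]; last exact: ideal0.
  apply: idealM; apply: mem_mono => /=.
  have ka : (k <= mdeg a)%N by rewrite -rk_mdegE an leq_addr.
  have -> : mdeg (a - b)%MM = (mdeg a - mdeg b)%N.
    by rewrite -{2}(submK ba) mdegD addnK.
  apply: leq_sub => //; rewrite -bE; exact: (leq_bigmax i0).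
have -> : \sum_i (g i + (if i == i0 then c * mon x (a - b)%MM else 0)) * j i =
    \sum_i g i * j i + c * mon x (a - b)%MM * j i0.
  transitivity (\sum_i (g i * j i + (if i == i0 then c * mon x (a - b)%MM else 0) * j i)).
    by apply: eq_bigr => i _; rewrite mulrDl.
  rewrite big_split; congr (_ + _).
  by rewrite (bigD1 i0) //= eqxx big1 ?addr0 // => i /negPf ->; rewrite mul0r.
have {}hj : G (rk a).+1 (mon x (a - b)%MM * (j i0 - mon x b)).
  have [_] := hj i0; rewrite bE => hb.
  by rewrite mulrC -{1}(submK ba) addmC; apply: G_mulS => //; exact: G_mon.
have -> : u - (\sum_i g i * j i + c * mon x (a - b)%MM * j i0) =
   (u - \sum_i g i * j i - c * mon x a) - c * (mon x (a - b)%MM * (j i0 - mon x b)).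
  rewrite -{2}(submK ba) monD; ring.
by apply: idealB => //; apply: idealM; rewrite -an.
Qed.

Section NoethDivision.
Hypothesis noethT : noetherian T.

(** The uniform loss [C] of the division puts [u] in the product modulo every [M k]; Krull's
    intersection theorem removes the error. *)
Lemma artin_rees J :
  exists c, forall N u, J u -> M (N + c) u -> idl_mul (M N) J u.
Proof.
have [r [j [C [Jj h]]]] := division J; exists C => N u Ju Mu.
apply: (krull_intersection locT noethT) => k.
have [g [Mg hg]] := h (N + C)%N k u Ju Mu.
exists (\sum_i g i * j i); last by exists (u - \sum_i g i * j i) => //; rewrite addrC subrK.
apply: ideal_sum => i _; apply: mem_gen; exists (g i); last by exists (j i).
by have := Mg i; rewrite addnK.
Qed.

(** By Artin-Rees for P + (v), the error term of v u has the form v g modulo [P] with g in [M N];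
    primality cancels [v] from v (u - g). *)
Lemma colon_uniform P (v : T) : is_prime P -> ~ P v ->
  exists c, forall N u, idl_add P (M (N + c)) (v * u) -> idl_add P (M N) u.
Proof.
move=> [_ _ Pprime] Pv; have [c hc] := artin_rees (idl_addM P v (idl_full T)).
exists c => N u [p Pp [n Mn e]].
have : idl_addM P v (M N) n.
  have : idl_addM P v (idl_full T) n.
    exists (- p); first exact: idealN.
    by exists u => //; rewrite -e; ring.
  move=> /hc /(_ Mn); apply: gen_sub => _ [s Ms [_ [q Pq [t _ <-]] <-]].
  rewrite mulrDr; apply: idealD; first by apply: idl_addMl; exact: idealM.
  by rewrite mulrCA; apply: idl_addMr; exact: idealMr.
move=> [q Pq [g Mg en]].
have : P (v * (u - g)).
  by rewrite mulrBr -e -en addrA addrK; exact: idealD.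
move=> /Pprime [//|Pug]; exists (u - g) => //.
by exists g => //; rewrite subrK.
Qed.

(** The Hilbert-Samuel function of T/J, that is, the length of T/(J + M N). *)
Definition hilb J N : nat := #|[set t : 'X_{1..d < N} | ~~ `[< inits x J t >]]%SET|.

(* For [b] outside the initial exponents of [P], multiplication by [v] produces
   an exponent that is initial for [v G (rk b)] but not for [v G (rk b).+1], both
   taken modulo [P + M (N + c)]; this assignment is injective in [b]. *)
Lemma hilb_drop P L (v : T) : is_prime P -> P `<=` L -> L v -> ~ P v ->
  exists c, forall N, (hilb L (N + c) + hilb P N <= hilb P (N + c))%N.
Proof.
move=> Pp PL Lv Pv; have [c hc] := colon_uniform Pp Pv; exists c => N.
pose F n := idl_add (idl_addM P v (G n)) (M (N + c)).
have FP n : P `<=` F n by move=> p Pp'; apply: idl_addl; exact: idl_addMl.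
have FM n : M (N + c) `<=` F n by move=> u; exact: idl_addr.
have Fle k n : (k <= n)%N -> F n `<=` F k.
  move=> kn _ [_ [p Pp' [g Gg <-]] [u Mu <-]]; apply: idealD; last exact: idl_addr.
  by apply: idl_addl; exists p => //; exists g => //; exact: G_le Gg.
have FL n a : (mdeg a < N + c)%N -> inits x (F n) a -> inits x L a.
  move=> aN h; apply: (@inits_addM _ _ _ _ (N + c)) => //; move: a {aN} h.
  apply: initsS => _ [_ [p Pp' [g Gg <-]] [u Mu <-]].
  exists (p + v * g); last by exists u.
  by apply: idealD; [exact: PL|exact: idealMr].
have key (b : 'X_{1..d < N}) : exists a : 'X_{1..d < N + c}, ~ inits x P b ->
    inits x (F (rk b)) a /\ ~ inits x (F (rk b).+1) a.
  have bN : (mdeg b < N + c)%N by exact: leq_trans (bmdeg b) (leq_addr _ _).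
  have [Pb|Pb] := pselect (inits x P b); first by exists (BMultinom bN).
  have : exists a, inits x (F (rk b)) a /\ ~ inits x (F (rk b).+1) a.
    (* If no exponent is gained, the two steps of [F] coincide, so v x^b equals v g modulo P + M (N
       + c) with g in the next step of [G]. Cancelling [v] makes [b] initial for [P]. *)
    apply: contrapT => /forallNP none; apply: Pb.
    have sub : F (rk b) `<=` F (rk b).+1.
      apply: (@inits_sub _ _ x locT _ _ (N + c)); [exact: Fle|exact: FM|].
      by move=> a ha; apply: contrapT => na; exact: (none a).
    have /sub [_ [p Pp' [g Gg <-]] [u Mu e]] : F (rk b) (v * mon x b).
      by apply: idl_addl; apply: idl_addMr; exact: G_mon.
    have [q Pq [w Mw eq]] : idl_add P (M N) (mon x b - g).
      apply: hc; exists p => //; exists u => //.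
      by rewrite mulrBr -e; ring.
    exists q; split=> //.
    rewrite (_ : q - _ = - (g + w)); last by rewrite -(subrK g (mon x b)) -eq; ring.
    apply: idealN; apply: idealD => //.
    by apply: M_Grk Mw; exact: bmdeg.
  move=> [a [ha na]]; have aN : (mdeg a < N + c)%N.
    by rewrite ltnNge; apply/negP => /(inits_M (FM (rk b).+1)).
  by exists (BMultinom aN).
have /choice [phi hphi] := key.
pose A := [set t : 'X_{1..d < N} | ~~ `[< inits x P t >]]%SET.
pose B := [set t : 'X_{1..d < N + c} | ~~ `[< inits x P t >] & `[< inits x L t >]]%SET.
have AB : (#|A| <= #|B|)%N.
  have inj : {in A &, injective phi}.
    have aux s t : s \in A -> t \in A -> (rk s < rk t)%N -> phi s <> phi t.
      rewrite !inE => /asboolPn As /asboolPn At st e.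
      have [_ h1] := hphi _ As; have [h2 _] := hphi _ At; apply: h1; rewrite e.
      by move: h2; apply: initsS; exact: Fle.
    move=> s t As At e; apply: val_inj; apply: rk_inj.
    by case: (ltngtP (rk s) (rk t)) => // h; case: (aux _ _ _ _ h).
  rewrite -(card_in_imset inj); apply: subset_leq_card.
  apply/fintype.subsetP => _ /imsetP [t At ->]; move: At; rewrite !inE => /asboolPn At.
  have [h1 h2] := hphi _ At; apply/andP; split.
    by apply/asboolPn => h; apply: h2; move: h; apply: initsS; exact: FP.
  by apply/asboolP; apply: FL h1; exact: bmdeg.
rewrite {1 3}/hilb; set HL := [set _ | _]%SET; set HP := [set _ | _]%SET.
have -> : HP = (HL :|: B)%SET.
  apply/setP => t; rewrite !inE; case: (asboolP (inits x P t)) => /= h; last by rewrite orNb.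
  by rewrite orbF asboolT //; exact: (initsS PL).
rewrite cardsU (_ : HL :&: B = finset.set0)%SET.
  by rewrite cards0 subn0 leq_add2l.
by apply/setP => t; rewrite !inE; case: asboolP => //= _; rewrite andbF.
Qed.

End NoethDivision.
End Division.

(** * Hilbert functions and chains of primes *)

Section Dimension.
Context (T : comPzRingType) (d : nat) (x : 'I_d -> T).
Implicit Types (a b : 'X_{1..d}) (J L P : ideal T).
Local Notation M := (M x).
Local Notation G := (G x).
Hypothesis locT : is_local (M 1).

(** Iterating the drop gives k g(n) <= f(n + k c); the choice k = n bounds n g(n) by the value of
    [f] at n (c + 1). *)
Lemma growth_drop (f g : nat -> nat) c C e :
  (forall k n, (k <= n)%N -> (g k <= g n)%N) ->
  (forall n, (g (n + c) + f n <= f (n + c))%N) ->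
  (forall n, (f n <= C * n ^ e)%N) ->
  forall n, (n * g n <= C * c.+1 ^ e * n ^ e)%N.
Proof.
move=> gmono drop fb n.
have h k : (k * g n <= f (n + k * c))%N.
  elim: k => [//|k IH].
  rewrite mulSn [(k.+1 * c)%N]mulSn addnCA [(c + _)%N]addnC.
  by apply: leq_trans (drop _); apply: leq_add => //; apply: gmono; lia.
apply: leq_trans (h n) _; apply: leq_trans (fb _) _.
by rewrite -mulnS mulnC [(n * _)%N]mulnC expnMn mulnC mulnA.
Qed.

Local Notation hilb := (hilb x).

Lemma hilb_mono J k n : (k <= n)%N -> (hilb J k <= hilb J n)%N.
Proof.
move=> kn; have wP (t : 'X_{1..d < k}) : (mdeg t < n)%N by exact: leq_trans (bmdeg t) kn.
pose w t := BMultinom (wP t).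
have w_inj : injective w by move=> s t [] /val_inj.
rewrite /hilb -(card_imset _ w_inj); apply: subset_leq_card.
by apply/fintype.subsetP => _ /imsetP [t + ->]; rewrite !inE.
Qed.

Lemma hilb_sub J L n : J `<=` L -> (hilb L n <= hilb J n)%N.
Proof.
move=> JL; apply: subset_leq_card; apply/fintype.subsetP => t; rewrite !inE.
by apply: contra => /asboolP h; apply/asboolP; exact: (initsS JL).
Qed.

Lemma card_bmnm n : (#|{: 'X_{1..d < n}}| <= n ^ d)%N.
Proof.
have wP (t : 'X_{1..d < n}) i : (t i < n)%N.
  by apply: leq_ltn_trans (bmdeg t); rewrite mdegE (bigD1 i) //= leq_addr.
pose w t := [ffun i => Ordinal (wP t i)].
have w_inj : injective w.
  by move=> s t /ffunP h; apply/val_inj/mnmP => i; have := h i; rewrite !ffunE => -[].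
rewrite -(card_imset _ w_inj); apply: leq_trans (max_card _) _.
by rewrite card_ffun !card_ord.
Qed.

Lemma hilb_le J n : (hilb J n <= n ^ d)%N.
Proof. exact: leq_trans (max_card _) (card_bmnm n). Qed.

Lemma hilb0 J : hilb J 0 = 0%N.
Proof.
apply/eqP; rewrite -leqn0; apply: leq_trans (max_card _) _.
by rewrite leqn0; apply/eqP/eq_card0 => t; have := bmdeg t; rewrite ltn0.
Qed.

Lemma inits0 J : ~ J 1 -> ~ inits x J 0%MM.
Proof.
move=> J1 [j [Jj]]; rewrite mon0 => h; apply: (local1 locT).
have : M 1 (j - 1).
  apply: monoS h => a /=; rewrite rk_lt => h; rewrite lt0n mdeg_eq0.
  by apply: contraTneq h => ->; rewrite ltxx.
move/idealN; rewrite opprB => /(idealBl (I := M 1)); apply.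
exact: (local_proper locT J1).
Qed.

Lemma hilb_gt0 J n : ~ J 1 -> (0 < hilb J n.+1)%N.
Proof.
move=> J1; apply/card_gt0P; exists bm0; rewrite inE; apply/asboolPn.
exact: inits0.
Qed.

(** The bound is divided by n. The case e = 0 fails at n = C + 1, because [hilb] is positive
    there. *)
Lemma growth_pred J C e : ~ J 1 -> (forall n, (n * hilb J n <= C * n ^ e)%N) ->
  (0 < e)%N /\ forall n, (hilb J n <= C * n ^ e.-1)%N.
Proof.
move=> J1 h; case: e h => [|e] h; last first.
  split=> // -[|n]; first by rewrite hilb0.
  by have := h n.+1; rewrite expnS mulnCA leq_pmul2l.
have := h C.+1; have := hilb_gt0 C J1; nia.
Qed.

Section NoethDimension.
Hypothesis noethT : noetherian T.

(** Each step of the chain lowers the degree of the growth bound by one, and the degree cannot drop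
    below zero. *)
Lemma chain_length_le n (p : nat -> set T) P e C : prime_chain n p -> ideal_set P = p 0%N ->
  (forall k, (hilb P k <= C * k ^ e)%N) -> (n <= e)%N.
Proof.
elim: n p P e C => [//|n IH] p P e C [pP plt] Pp hP.
have [[q1 q2 q3] pr1] := pP 1%N isT.
pose L := Ideal (And3 q1 q2 q3).
have [PL /existsNP [v /not_implyP [Lv Pv]]] := plt 0%N isT.
have Pprime : is_prime P by rewrite Pp; exact: pP.
have [|||c hc] := hilb_drop locT noethT (v := v) (L := L) Pprime => //; try by rewrite Pp.
have [] := @growth_pred L (C * c.+1 ^ e) e pr1.
  by apply: growth_drop hc hP => k k'; exact: hilb_mono.
case: e hP => // e hP _ hL; rewrite ltnS.
have hp : prime_chain n (fun i => p i.+1) by split=> i ni; [exact: pP|exact: plt].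
by move=> _; exact: (IH _ L e _ hp erefl hL).
Qed.

Lemma dim_le n (p : nat -> set T) : prime_chain n p -> (n <= d)%N.
Proof.
move=> h; have [hI _ _] := h.1 0%N isT.
apply: (@chain_length_le _ _ (Ideal hI) d 1 h) => // k.
by rewrite mul1n; exact: hilb_le.
Qed.

(* A relation between the monomials would make the Hilbert function of the ring
   grow with degree less than [d], leaving no room for a chain of length [d]. *)
Lemma inits_idl0_dim (p : nat -> set T) : prime_chain d p -> inits x (idl0 T) = set0.
Proof.
move=> h; apply: contrapT => /eqP/set0P [a0 ha0].
have [[hI h1 _] _] := (h.1 0%N isT, h.1).
have one0 : ~ idl0 T 1 by move=> e; apply: h1; rewrite e; case: hI.
(* Translation by [a0] embeds the exponents of degree less than [n] into the initial exponents,
   which [hilb] does not count. *)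
have drop n : (hilb (idl0 T) (n + mdeg a0) + #|{: 'X_{1..d < n}}| <=
    #|{: 'X_{1..d < n + mdeg a0}}|)%N.
  pose A := [set t : 'X_{1..d < n + mdeg a0} | `[< inits x (idl0 T) t >]]%SET.
  have wP (t : 'X_{1..d < n}) : (mdeg (t + a0)%MM < n + mdeg a0)%N.
    by rewrite mdegD ltn_add2r; exact: bmdeg.
  pose w t := BMultinom (wP t).
  have w_inj : injective w by move=> s t /(congr1 (@bmnm _ _)) /= /addIm /val_inj.
  have : (#|{: 'X_{1..d < n}}| <= #|A|)%N.
    rewrite -(card_imset _ w_inj); apply: subset_leq_card.
    apply/fintype.subsetP => _ /imsetP [t _ ->]; rewrite inE; apply/asboolP => /=.
    by rewrite addmC; exact: inits_up.
  move/(leq_add (leqnn (hilb (idl0 T) (n + mdeg a0)))) => /leq_trans; apply.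
  rewrite addnC -(cardsC A) leq_add2l; apply: subset_leq_card.
  by apply/fintype.subsetP => t; rewrite !inE.
have [] := @growth_pred (idl0 T) (1 * (mdeg a0).+1 ^ d) d one0.
  apply: growth_drop drop _; first by move=> k k'; exact: hilb_mono.
  by move=> n; rewrite mul1n; exact: card_bmnm.
(* The bound of degree d - 1 passes from the zero ideal to the first prime of the chain, which has
   the smaller Hilbert function. *)
move=> d0 hb; have := @chain_length_le d p (Ideal hI) d.-1 (1 * (mdeg a0).+1 ^ d) h.
move=> hh; suff : (d <= d.-1)%N by rewrite -ltnS prednK // ltnn.
apply: hh => // k; apply: leq_trans (hb k); apply: hilb_sub => _ ->.
by case: hI.
Qed.

End NoethDimension.
End Dimension.

(** * Regular local rings *)

(* Local rings in which the monomials in the generators [x] of the maximal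
   ideal are independent, i.e. the associated graded ring is polynomial. *)
Section FreeMonomials.
Context (T : comPzRingType) (d : nat) (x : 'I_d -> T).
Implicit Types (a b : 'X_{1..d}) (U V : set 'X_{1..d}) (J L P : ideal T).
Local Notation M := (M x).
Local Notation G := (G x).
Local Notation mon := (mon x).
Local Notation mono := (mono x).
Hypothesis locT : is_local (M 1).
Hypothesis freeT : inits x (idl0 T) = set0.

(** For a unit [c], the element 0 would have [a] as an initial exponent. *)
Lemma free_mon a c : G (rk a).+1 (c * mon a) -> M 1 c.
Proof.
move=> h; apply: contrapT => /(localU locT) [e ce].
suff : set0 a by [].
rewrite -freeT; exists 0; split=> //.
rewrite sub0r; apply: idealN.
by rewrite -[mon a]mul1r -ce mulrAC mulrC; exact: idealM.
Qed.

Definition upset U := forall a b, U a -> U (a + b)%MM.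

(** At each rank below [n], freeness forces the coefficient into [M 1]; the term is then rewritten
    with monomials of higher rank, whose exponents stay in the upset [U]. *)
Lemma mono_G U n u : upset U -> mono U u -> G n u ->
  mono (U `&` [set a | (n <= rk a)%N]) u.
Proof.
move=> upU Uu; elim: n => [_|n IH Gu].
  by move: u Uu; apply: monoS => a Ua; split.
have [//|[a [c [an Ua h]]]] := mono_split (IH (G_le (leqnSn n) Gu)).
have Mc : M 1 c.
  apply: (@free_mon a); rewrite an (_ : c * mon a = u - (u - c * mon a)); last by ring.
  by apply: idealB => //; apply: monoS h => b [].
rewrite -(subrK (c * mon a) u); apply: idealD => //.
apply: (@mono_mul _ _ _ [set b | (0 < mdeg b)%N] [set a]) Mc _; last exact: mem_mono.
move=> b _ /= b0 ->; split; first by rewrite addmC; exact: upU.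
by rewrite /= -an; apply: mdeg_rk; rewrite mdegD -[ltnLHS]add0n ltn_add2r.
Qed.

(** If [a] were initial but outside [U], then by [mono_G] the element led by [a] would only involve
    ranks above that of [a], and so would x^a itself, against [free_mon]. *)
Lemma inits_mono U : upset U -> inits x (mono U) = U.
Proof.
move=> upU; apply/seteqP; split=> [a [j [Uj h]]|a Ua]; last first.
  by exists (mon a); split; [exact: mem_mono|rewrite subrr; exact: ideal0].
apply: contrapT => nUa; apply: (local1 locT); apply: (@free_mon a); rewrite mul1r.
rewrite -(subKr j (mon a)); apply: idealB => //.
have Gj : G (rk a) j.
  by apply: (idealBl (b := mon a)); [exact: G_le h|exact: G_mon].
move: (mono_G upU Uj Gj); apply: monoS => b [Ub /=].
rewrite leq_eqVlt => /orP[/eqP /rk_inj e|//].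
by case: nUa; rewrite e.
Qed.

Section NoethFree.
Hypothesis noethT : noetherian T.

(** A normal form modulo [J]: leading terms are cancelled until one is not initial for [J]. If this
    never happened, [u] would lie in J + M k for all k, hence in [J] by Krull. *)
Lemma residue J u : ~ J u -> exists a c v, [/\ J (u - v), ~ inits x J a, ~ M 1 c,
  G (rk a) v & G (rk a).+1 (v - c * mon a)].
Proof.
move=> Ju; apply: contrapT => none; apply: Ju.
suff h n : idl_add J (G n) u.
  apply: (krull_intersection locT noethT) => k.
  have [j Jj [v /G_M Mv <-]] := h #|{: 'X_{1..d < k}}|.
  by exists j => //; exists v.
elim: n => [|n [j Jj [v Gv e]]]; first by apply: idl_addr; exact: G0.
have [Gv'|[a [c [an Mc h]]]] := lead Gv; first by exists j => //; exists v.
have [[w [Jw hw]]|nJa] := pselect (inits x J a); last first.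
  by case: none; exists a, c, v; rewrite an; split=> //; rewrite -e addrK.
exists (j + c * w); first by apply: idealD => //; exact: idealM.
exists (v - c * w); last by rewrite -e; ring.
rewrite (_ : v - c * w = (v - c * mon a) - c * (w - mon a)); last by ring.
by apply: idealB => //; rewrite -an; exact: idealM.
Qed.

(** The residues of two elements outside [J] have unit leading coefficients at non-initial [a] and
    [b], so their product leads with a + b. *)
Lemma prime_inits J : ~ J 1 ->
  (forall a b, inits x J (a + b)%MM -> inits x J a \/ inits x J b) -> is_prime J.
Proof.
move=> J1 h; split=> //; first exact: idealP.
move=> u v Juv; apply: contrapT => /not_orP [/residue [a [c [u' [Ju na Mc Ga ha]]]]].
move=> /residue [b [c' [v' [Jv nb Mc' Gb hb]]]].
have Ju'v' : J (u' * v').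
  have -> : u' * v' = u * v - (u - u') * v - u' * (v - v') by ring.
  by apply: idealB; [apply: idealB => //; exact: idealMr|exact: idealM].
have [e ce] := localU locT Mc; have [e' ce'] := localU locT Mc'.
suff /h [] : inits x J (a + b)%MM by [].
exists (e * e' * (u' * v')); split; first exact: idealM.
have -> : e * e' * (u' * v') - mon (a + b)%MM =
    e * e' * ((u' - c * mon a) * v' + c * ((v' - c' * mon b) * mon a)).
  have e1 : mon (a + b)%MM = (c * e) * (c' * e') * (mon a * mon b).
    by rewrite ce ce' !mul1r monD.
  by rewrite e1; ring.
apply: idealM; apply: idealD; first exact: G_mulS.
by apply: idealM; rewrite addmC; apply: G_mulS => //; exact: G_mon.
Qed.

(** The ideal [mono (coordU i)] is generated by the first [i] of the elements [x]. *)
Definition coordU i : set 'X_{1..d} := [set a | exists2 j : 'I_d, (j < i)%N & a j != 0%N].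

Lemma coordU_up i : upset (coordU i).
Proof.
by move=> a b [j ji aj]; exists j => //; rewrite mnmDE addn_eq0 negb_and aj.
Qed.

Lemma mono1 U : upset U -> ~ U 0%MM -> ~ mono U 1.
Proof.
move=> upU U0 h; apply: U0; rewrite -(inits_mono upU).
by exists 1; rewrite mon0 subrr; split=> //; exact: ideal0.
Qed.

Lemma coordU_prime i : is_prime (mono (coordU i)).
Proof.
have up := @coordU_up i.
apply: prime_inits; first by apply: mono1 => // -[j _]; rewrite mnm0E.
move=> a b; rewrite inits_mono // => -[j ji]; rewrite mnmDE addn_eq0 negb_and.
by case/orP => h; [left|right]; exists j.
Qed.

Lemma coordU_chain : prime_chain d (fun i => mono (coordU i)).
Proof.
split=> [i _|i id]; first exact: coordU_prime.
split; first by apply: monoS => a [j ji aj]; exists j => //; exact: leqW.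
move=> /(_ (mon U_(Ordinal id)%MM)) h.
have [] : coordU i U_(Ordinal id)%MM; last first.
  by move=> j ji; rewrite mnm1E; case: (Ordinal id =P j) ji => [<-|_ _]; rewrite ?ltnn ?eqxx.
rewrite -(inits_mono (@coordU_up i)); exists (mon U_(Ordinal id)%MM).
split; last by rewrite subrr; exact: ideal0.
by apply: h; apply: mem_mono; exists (Ordinal id) => //=; rewrite mnm1E eqxx.
Qed.

(** The coordinate primes form a chain of length [d]; the Hilbert function bound [dim_le] excludes
    longer ones. *)
Lemma krull_dim_free : krull_dim T d.
Proof.
split; first by exists (fun i => mono (coordU i)); exact: coordU_chain.
exact: (dim_le locT noethT).
Qed.

Lemma idl0_prime : is_prime (idl0 T).
Proof.
apply: prime_inits; last by rewrite freeT.
by move=> /= h; apply: (local1 locT); rewrite h; exact: ideal0.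
Qed.

End NoethFree.

(** * Ideals generated by powers of the parameters, and their socles *)

Definition powU t : set 'X_{1..d} := [set a | exists j, (t < a j)%N].

Lemma powU_up t : upset (powU t).
Proof. by move=> a b [j tj]; exists j; rewrite mnmDE; exact: ltn_addr. Qed.

Definition top_mnm t : 'X_{1..d} := [multinom t | i < d].

Lemma mon_top t : mon (top_mnm t) = (\prod_i x i) ^+ t.
Proof. by rewrite /mon -prodrXl; apply: eq_bigr => i _; rewrite mnmE. Qed.

Lemma powU_gen t : ideal_set (mono (powU t)) = ideal_gen (range (fun i => x i ^+ t.+1)).
Proof.
apply/seteqP; split.
  apply: (@mono_sub _ _ _ _ (gen _)) => a [j tj].
  rewrite /mon (bigD1 j) //= -(subnKC tj) exprD -mulrA.
  by apply: (@idealMr _ (gen _)); apply: mem_gen; exists j.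
apply: gen_sub => _ [j _ <-]; rewrite -monUn; apply: mem_mono.
by exists j; rewrite mulmnE mnm1E eqxx mul1n.
Qed.

Lemma top_notin t : ~ mono (powU t) (mon (top_mnm t)).
Proof.
move=> h; have [] : powU t (top_mnm t); last by move=> j; rewrite mnmE ltnn.
rewrite -(inits_mono (@powU_up t)); exists (mon (top_mnm t)).
by split=> //; rewrite subrr; exact: ideal0.
Qed.

Lemma powU_deg t a : (d * t < mdeg a)%N -> powU t a.
Proof.
rewrite mdegE => h; have /existsP [j aj] : [exists j, t < a j]%N; last by exists j.
apply: contraTT h; rewrite negb_exists -leqNgt => /forallP h.
have -> : (d * t = \sum_(i < d) t)%N by rewrite sum_nat_const card_ord.
by apply: leq_sum => i _; rewrite leqNgt.
Qed.

Lemma top_M1 t v : M 1 v -> mono (powU t) (mon (top_mnm t) * v).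
Proof.
move=> Mv; apply: (@mono_mul _ _ _ [set top_mnm t] [set b | (0 < mdeg b)%N]) Mv.
  move=> _ b -> /=; rewrite mdegE => b0.
  have /existsP [j bj] : [exists j, 0 < b j]%N.
    apply: contraTT b0; rewrite negb_exists -leqNgt => /forallP h.
    by rewrite big1 // => i _; apply/eqP; rewrite -leqn0 leqNgt.
  by exists j; rewrite mnmDE mnmE -[ltnLHS]addn0 ltn_add2l.
exact: mem_mono.
Qed.

(** Leading terms of [u] are removed one by one. An exponent [a] outside [powU t] has entries at
    most [t], while each a + U_i must be in [powU t]; so [a] is the top exponent. Beyond degree d t
    everything is in the ideal. *)
Lemma socle t u : (forall v, M 1 v -> mono (powU t) (u * v)) ->
  idl_addM (mono (powU t)) (mon (top_mnm t)) (idl_full T) u.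
Proof.
move=> hu; set W := idl_addM _ _ _.
have QW : mono (powU t) `<=` W by move=> w; exact: idl_addMl.
suff hn n : idl_add W (G n) u.
  have [w Ww [v /G_M Mv <-]] := hn #|{: 'X_{1..d < (d * t).+1}}|.
  by apply: idealD => //; apply/QW; apply: monoS Mv => a /=; exact: powU_deg.
elim: n => [|n [w Ww [v Gv e]]]; first by apply: idl_addr; exact: G0.
have hv y : M 1 y -> mono (powU t) (v * y).
  move=> My; apply: (idealBl (b := - (w * y))).
    by rewrite opprK -mulrDl addrC e; exact: hu.
  apply: idealN; have [q Qq [r _ <-]] := Ww.
  rewrite mulrDl; apply: idealD; first exact: idealMr.
  by rewrite mulrAC; apply: idealMr; exact: top_M1.
have [Gv'|[a [c [an Mc h]]]] := lead Gv; first by exists w => //; exists v.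
suff Wa : W (mon a).
  exists (w + c * mon a); first by apply: idealD => //; exact: idealM.
  by exists (v - c * mon a) => //; rewrite -e; ring.
have [Ua|nUa] := pselect (powU t a); first by apply: QW; exact: mem_mono.
have at' j : (a j <= t)%N by rewrite leqNgt; apply/negP => taj; apply: nUa; exists j.
have [/forallP eqt|] := boolP [forall j, a j == t].
  have -> : a = top_mnm t by apply/mnmP => j; rewrite mnmE; apply/eqP.
  exact: idl_addM1.
rewrite negb_forall => /existsP [i ai].
have [e' ce'] := localU locT Mc.
(* Up to a unit, v x_i is an element of the monomial ideal with leading exponent a + U_i. *)
have : powU t (a + U_(i))%MM.
  rewrite -(inits_mono (@powU_up t)); exists (e' * (v * x i)).
  split; first by apply: idealM; apply: hv; exact: M1_x.
  have -> : e' * (v * x i) - mon (a + U_(i))%MM = e' * ((v - c * mon a) * mon U_(i)%MM).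
    have e1 : mon (a + U_(i))%MM = (c * e') * (mon a * mon U_(i)%MM).
      by rewrite ce' mul1r monD.
    by rewrite e1 monU; ring.
  by apply: idealM; apply: G_mulS; [rewrite an|exact: G_mon].
move=> [j]; rewrite mnmDE mnm1E; case: eqP => [<-|_].
  by rewrite addn1 ltnS leqNgt ltn_neqAle ai at'.
by rewrite addn0 ltnNge at'.
Qed.

End FreeMonomials.

(** * Duality modulo an ideal [Q] whose quotient has its socle spanned by [s] *)

Section Duality.
Context (T : comPzRingType) (d : nat) (x : 'I_d -> T).
Implicit Types (J L : ideal T).
Local Notation M := (M x).
Hypothesis locT : is_local (M 1).
Hypothesis noethT : noetherian T.
Context (Q : ideal T) (s : T) (N : nat).
Hypothesis MQ : M N `<=` Q.
Hypothesis sM : forall v, M 1 v -> Q (s * v).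
Hypothesis socQ : forall u, (forall v, M 1 v -> Q (u * v)) -> idl_addM Q s (idl_full T) u.

(** With the least power [M k.+1] that multiplies [u] into [L], some element of [M k] still takes
    [u] outside [L]. *)
Lemma socle_elt L u : M N `<=` L -> ~ L u ->
  exists v, ~ L (u * v) /\ forall w, M 1 w -> L (u * v * w).
Proof.
move=> NL Lu.
have : exists k, `[< forall w, M k w -> L (u * w) >].
  by exists N; apply/asboolP => w /NL; exact: idealM.
move=> /ex_minnP [[|k] /asboolP hk kmin].
  by case: Lu; rewrite -[u]mulr1; apply: hk; exact: M0.
have : ~ forall w, M k w -> L (u * w).
  by move=> h; have := kmin k (asboolT h); rewrite ltnn.
move=> /existsNP [v /not_implyP [Mv Lv]]; exists v; split=> // w Mw.
by rewrite -mulrA; apply: hk; rewrite -addn1; exact: M_mul.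
Qed.

(** Modulo [Q], [w] is a multiple of [s]; a multiplier in the maximal ideal would put [w] in [Q], so
    it is a unit. *)
Lemma socle_unit w : ~ Q w -> (forall v, M 1 v -> Q (w * v)) ->
  exists e, Q (e * w - s).
Proof.
move=> Qw /socQ [q Qq [r _ qr]].
have [e re] : exists e, r * e = 1.
  apply: (localU locT) => Mr; apply: Qw; rewrite -qr; apply: idealD => //; exact: sM.
exists e; rewrite -qr (_ : _ - _ = e * q + s * (r * e - 1)); last by ring.
by rewrite re subrr mulr0 addr0; exact: idealM.
Qed.

(* Noetherian induction from [Q] up to [J] by steps [L < L + (a)] with [m a] in
   [L]; each step lowers [colon Q L] by exactly one socle dimension. *)
Lemma colon_colon J : Q `<=` J -> colon Q (colon Q J) `<=` J.
Proof.
move=> QJ.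
have [] := @noetherian_max _ noethT
  (fun L => [/\ Q `<=` L, L `<=` J & colon Q (colon Q L) `<=` L]) Q.
  split=> // u h; rewrite -[u]mulr1; apply: h => v Qv; exact: idealM.
move=> L [[QL LJ DL] Lmax].
have [JL|/existsNP [a0 /not_implyP [Ja0 La0]]] := pselect (J `<=` L).
  move=> u hu; apply/LJ/DL => v hv; apply: hu => w /JL; exact: hv.
have [v0 [La aM]] := socle_elt (subset_trans MQ QL) La0.
pose a := a0 * v0; have Ja : J a by exact: idealMr.
exfalso; apply: (La); apply: (Lmax (idl_addM L a (idl_full T))); last exact: idl_addM1.
  2: by move=> u Lu; exact: idl_addMl.
split.
- by move=> u /QL Lu; exact: idl_addMl.
- by move=> _ [l /LJ Jl [t _ <-]]; apply: idealD => //; exact: idealMr.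
pose K := colon Q L; pose K' := colon Q (idl_addM L a (idl_full T)).
have K'I u : K u -> Q (u * a) -> K' u.
  move=> Ku Qua _ [l Ll [t _ <-]]; rewrite mulrDr; apply: idealD; first exact: Ku.
  by rewrite mulrA; exact: idealMr.
have killed u v : K u -> M 1 v -> Q (u * a * v).
  by move=> Ku Mv; rewrite -mulrA; apply: Ku; exact: aM.
have [u0 [Ku0 Qu0]] : exists u0, K u0 /\ ~ Q (u0 * a).
  have : ~ colon Q K a by move/DL; exact: La.
  move=> /existsNP [u0 /not_implyP [Ku0 h]]; exists u0; split=> //.
  by rewrite mulrC.
have [e he] := socle_unit Qu0 (fun v => killed _ v Ku0).
have red w : (forall v, M 1 v -> Q (w * v)) -> exists r, Q (w - r * (u0 * a)).
  move=> /socQ [q Qq [r _ <-]]; exists (r * e).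
  rewrite (_ : _ - _ = q - r * (e * (u0 * a) - s)); last by ring.
  by apply: idealB => //; exact: idealM.
move=> b hb.
(* The maximal ideal multiplies [u0] into [K'], so b u0 is a socle element. Then b - a r sends both
   [u0] and [K'] into [Q]; these generate [K], and [DL] gives membership in [L]. *)
have [r hr] : exists r, Q (b * u0 - r * (u0 * a)).
  apply: red => v Mv; rewrite -mulrA; apply: hb; apply: K'I.
    exact: (idealMr (I := K)).
  by rewrite mulrAC; exact: killed.
exists (b - a * r); last by exists r => //; rewrite subrK.
apply: DL => u Ku.
have [r' hr'] := red (u * a) (fun v => killed u v Ku).
have hK' : K' (u - r' * u0).
  apply: K'I; first by apply: (idealB (I := K)) => //; exact: idealM.
  by rewrite mulrBl -mulrA.
rewrite (_ : (b - a * r) * u = b * (u - r' * u0) + r' * (b * u0 - r * (u0 * a))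
  - r * (u * a - r' * (u0 * a))); last by ring.
apply: idealB; last exact: idealM.
by apply: idealD; [exact: hb|exact: idealM].
Qed.

(** The double colon property provides a multiplier of [J] into [Q] that keeps [h] outside; a
    further multiple moves the product into the socle and normalizes it to [s]. *)
Lemma separate_socle J h : Q `<=` J -> ~ J h ->
  exists u, (forall j, J j -> Q (u * j)) /\ Q (u * h - s).
Proof.
move=> QJ Jh.
have /existsNP [u /not_implyP [hu Qhu]] : ~ colon Q (colon Q J) h.
  by move/(colon_colon QJ).
have [v [Qv Mv]] := socle_elt MQ Qhu.
have [e he] := socle_unit Qv Mv.
exists (e * v * u); split=> [j Jj|].
  by rewrite -mulrA; apply: idealM; exact: hu.
by rewrite (_ : e * v * u * h = e * (h * u * v)) //; ring.
Qed.

End Duality.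

(** * Completion *)

Section Completed.
Context (R T : comPzRingType) (pi : {rmorphism R -> T}) (d : nat) (x : 'I_d -> R).
(** The completion enters only through a separated and complete filtration [K] for which R is dense
    and which induces the filtration [M x] on R. *)
Context (K : nat -> ideal T).
Let y := pi \o x.
Hypothesis KS : forall n u, K n.+1 u -> K n u.
Hypothesis Ksep : forall u, (forall n, K n u) -> u = 0.
Hypothesis Kdense : forall u n, exists a, K n (u - pi a).
Hypothesis Kpi : forall n a, K n (pi a) <-> M x n a.
Hypothesis Kcomplete : forall c : nat -> R, (forall n, M x n (c n.+1 - c n)) ->
  exists v, forall n, K n (v - pi (c n)).

Lemma K_le k n u : (k <= n)%N -> K n u -> K k u.
Proof.
elim: n => [|n IH]; first by rewrite leqn0 => /eqP ->.
by rewrite leq_eqVlt => /orP[/eqP -> //|kn /KS]; exact: IH.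
Qed.

Lemma pi_mon a : pi (mon x a) = mon y a.
Proof. by rewrite rmorph_prod; apply: eq_bigr => i _; rewrite rmorphXn. Qed.

Lemma pi_approx n k u a b : (k <= n)%N -> K n (u - pi a) -> K k (u - pi b) ->
  M x k (b - a).
Proof.
move=> kn /(K_le kn) ua ub; apply/Kpi; rewrite rmorphB.
by rewrite (_ : _ - _ = (u - pi a) - (u - pi b)); [exact: idealB|ring].
Qed.

Lemma Kcomplete_seq (c : nat -> T) : (forall n, K n (c n.+1 - c n)) ->
  exists v, forall n, K n (v - c n).
Proof.
move=> hc; have /choice [b hb] : forall n, exists b, K n (c n - pi b).
  by move=> n; exact: Kdense.
have [n|v hv] := Kcomplete (c := b).
  apply: (@pi_approx n n (c n)) => //.
  rewrite (_ : _ - _ = (c n.+1 - pi (b n.+1)) - (c n.+1 - c n)); last by ring.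
  by apply: idealB => //; exact: KS.
exists v => n; rewrite (_ : _ - _ = (v - pi (b n)) - (c n - pi (b n))); last by ring.
exact: idealB.
Qed.

Lemma sub_mnm (a : 'X_{1..d}) n : (n <= mdeg a)%N ->
  exists b, (b <= a)%MM /\ mdeg b = n.
Proof.
elim: n => [_|n IH na].
  by exists 0%MM; rewrite mdeg0; split=> //; apply/mnm_lepP => i; rewrite mnm0E.
have [b [ba bn]] := IH (ltnW na).
have /existsP [i bi] : [exists i, b i < a i]%N.
  apply: contraTT na; rewrite negb_exists -leqNgt -bn !mdegE => /forallP h.
  by apply: leq_sum => i _; rewrite leqNgt.
exists (b + U_(i))%MM; rewrite mdegD mdeg1 bn addn1; split=> //.
apply/mnm_lepP => j; rewrite mnmDE mnm1E; case: eqP => [<-|_]; first by rewrite addn1.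
by rewrite addn0; apply/mnm_lepP.
Qed.

(** Any exponent of degree at least n + k splits off one of degree exactly [n]. Only finitely many
    monomials occur, so their coefficients can later be summed to limits. *)
Lemma M_coef n k w : M x (n + k) w -> exists r : 'X_{1..d < n.+1} -> R,
  (forall t, M x k (r t)) /\ w = \sum_(t : 'X_{1..d < n.+1} | mdeg t == n) r t * mon x t.
Proof.
have isI : is_ideal [set w | exists r : 'X_{1..d < n.+1} -> R,
    (forall t, M x k (r t)) /\ w = \sum_(t : 'X_{1..d < n.+1} | mdeg t == n) r t * mon x t].
  split.
  - exists (fun=> 0); split=> [t|]; first exact: ideal0.
    by rewrite big1 // => t _; rewrite mul0r.
  - move=> _ _ [r [hr ->]] [s [hs ->]]; exists (fun t => r t + s t).
    split=> [t|]; first exact: idealD.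
    by rewrite -big_split; apply: eq_bigr => t _; rewrite mulrDl.
  - move=> z _ [r [hr ->]]; exists (fun t => z * r t).
    split=> [t|]; first exact: idealM.
    by rewrite mulr_sumr; apply: eq_bigr => t _; rewrite mulrA.
move: w; apply: (@mono_sub _ _ _ _ (Ideal isI)) => a /= na.
have [b [ba bn]] := sub_mnm (leq_trans (leq_addr k n) na).
have bn' : (mdeg b < n.+1)%N by rewrite bn.
exists (fun t => if t == BMultinom bn' then mon x (a - b)%MM else 0); split.
  move=> t; case: (t =P _) => _; last exact: (@ideal0 _ (M x k)).
  apply: (@mem_mono _ _ x [set a | (k <= mdeg a)%N]) => /=.
  rewrite -(leq_add2l n) (leq_trans na) //.
  by rewrite -{1}(submK ba) mdegD bn addnC.
rewrite (bigD1 (BMultinom bn')) /= ?bn // eqxx big1 ?addr0.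
  by rewrite -monD submK.
by move=> t /andP[_ /negPf ->]; rewrite mul0r.
Qed.

(** An element of [K n] is a convergent series of elements of R in [M x n]. Collecting the
    coefficients of each monomial of degree [n] and passing to their limits expresses it by the
    monomials in [y]. *)
Lemma KE n u : K n u <-> M y n u.
Proof.
split; last by apply: mono_sub => a /= na; rewrite -pi_mon; apply/Kpi/mem_mono.
move=> Ku; have /choice [c hc] : forall k, exists a, K (n + k)%N (u - pi a).
  by move=> k; exact: Kdense.
have c0 : M x (n + 0) (c 0%N).
  rewrite addn0; apply/Kpi; rewrite -(subKr u (pi _)); apply: idealB => //.
  by have := hc 0%N; rewrite addn0.
have cS k : M x (n + k) (c k.+1 - c k).
  apply: (@pi_approx (n + k) (n + k) u) => //.
  by apply: KS; rewrite -addnS; exact: hc.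
pose e k := if k is l.+1 then c l.+1 - c l else c 0%N.
have /choice [r hr] : forall k, exists r : 'X_{1..d < n.+1} -> R,
    (forall t, M x k.-1 (r t)) /\ e k = \sum_(t : 'X_{1..d < n.+1} | mdeg t == n) r t * mon x t.
  by case=> [|k]; [exact: M_coef c0|exact: M_coef (cS k)].
have ce k : c k = \sum_(l < k.+1) e l.
  elim: k => [|k IH]; first by rewrite big_ord1.
  by rewrite big_ord_recr /= -IH addrC subrK.
have /choice [v hv] : forall t, exists v, forall k, K k (v - pi (\sum_(l < k.+1) r l t)).
  move=> t; have := Kcomplete (c := fun k => \sum_(l < k.+1) r l t); apply=> k.
  rewrite big_ord_recr /= addrAC subrr add0r.
  by have [h _] := hr k.+1; exact: h.
have -> : u = \sum_(t : 'X_{1..d < n.+1} | mdeg t == n) v t * mon y t.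
  apply/eqP; rewrite -subr_eq0; apply/eqP/Ksep => k.
  have -> : u - \sum_(t : 'X_{1..d < n.+1} | mdeg t == n) v t * mon y t = (u - pi (c k)) -
      \sum_(t : 'X_{1..d < n.+1} | mdeg t == n) (v t - pi (\sum_(l < k.+1) r l t)) * mon y t.
    have -> : pi (c k) =
        \sum_(t : 'X_{1..d < n.+1} | mdeg t == n) pi (\sum_(l < k.+1) r l t) * mon y t.
      rewrite ce rmorph_sum.
      transitivity (\sum_(l < k.+1) \sum_(t : 'X_{1..d < n.+1} | mdeg t == n) pi (r l t) * mon y t).
        apply: eq_bigr => l _; have [_ ->] := hr l.
        by rewrite rmorph_sum; apply: eq_bigr => t _; rewrite rmorphM pi_mon.
      rewrite exchange_big; apply: eq_bigr => t _.
      by rewrite rmorph_sum mulr_suml.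
    rewrite -[RHS]addrA -opprD -big_split; congr (_ - _); apply: eq_bigr => t _.
    by rewrite /= mulrBl addrC subrK.
  apply: idealB; first by apply: K_le (hc k); exact: leq_addl.
  by apply: ideal_sum => t _; exact: idealMr.
by apply: ideal_sum => t /eqP tn; apply: idealM; apply: mem_mono; rewrite /= tn.
Qed.

Section CompletedLocal.
Hypothesis locR : is_local (M x 1).

(** An element outside [M y 1] is approximated by units of R, whose inverses converge to its
    inverse. *)
Lemma completed_local : is_local (M y 1).
Proof.
split; last by move/KE; rewrite -(rmorph1 pi) => /Kpi; exact: (local1 locR).
(* The shift to n + 1 makes even the first approximation agree with [u] modulo [K 1], so that all of
   them are units. *)
move=> u nu; have /choice [b hb] : forall n, exists b, K n.+1 (u - pi b).
  by move=> n; exact: Kdense.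
have /choice [e he] : forall n, exists e, b n * e = 1.
  move=> n; apply: (localU locR) => /Kpi Kb; apply/nu/KE.
  by rewrite -(subrK (pi (b n)) u); apply: idealD => //; exact: (K_le _ (hb n)).
have [n|v hv] := Kcomplete (c := e).
  rewrite (_ : _ - _ = e n * e n.+1 * (b n - b n.+1)).
    by apply: idealM; apply: (@pi_approx n.+2 n u); [exact: leqW|exact: hb|exact/KS/hb].
  have /(congr1 ( *%R (e n.+1))) := he n; have /(congr1 ( *%R (e n))) := he n.+1.
  by rewrite !mulr1 => h1 h2; rewrite -{1}h2 -{2}h1; ring.
exists v; apply/eqP; rewrite -subr_eq0; apply/eqP/Ksep => n.
rewrite (_ : _ - _ = u * (v - pi (e n)) + pi (e n) * (u - pi (b n))).
  by apply: idealD; [exact: idealM|apply: idealM; exact: KS].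
by rewrite -(rmorph1 pi) -(he n) rmorphM; ring.
Qed.

(** Coefficients from T are approximated by elements of R modulo [K k]. Together with Krull's
    theorem this recovers an ideal of R from its extension. *)
Lemma gen_pi_approx (I : ideal R) w k :
  ideal_gen (pi @` ideal_set I) (pi w) -> idl_add I (M x k) w.
Proof.
have isI : is_ideal [set u | exists g, I g /\ K k (u - pi g)].
  split.
  - by exists 0; rewrite rmorph0 subr0; split; exact: ideal0.
  - move=> u v [g [Ig hg]] [h [Ih hh]]; exists (g + h); split; first exact: idealD.
    by rewrite rmorphD opprD addrACA; exact: idealD.
  - move=> r u [g [Ig hg]]; have [a ha] := Kdense r k.
    exists (a * g); split; first exact: idealM.
    rewrite rmorphM (_ : _ - _ = r * (u - pi g) + pi g * (r - pi a)); last by ring.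
    by apply: idealD; exact: idealM.
move=> /(gen_sub (I := Ideal isI)) [|g [Ig]].
  by move=> _ [g Ig <-]; exists g; rewrite subrr; split=> //; exact: ideal0.
rewrite -rmorphB => /Kpi h; exists g => //; exists (w - g) => //.
by rewrite addrC subrK.
Qed.

(** A relation with leading exponent [a] descends to R up to an error of degree above that of [a],
    which does not affect the leading term. *)
Lemma completed_free : inits x (idl0 R) = set0 -> inits y (idl0 T) = set0.
Proof.
move=> freeR; apply/seteqP; split=> // a [_ [->]]; rewrite sub0r => /idealN.
rewrite opprK => h; rewrite -freeR; exists 0; split=> //.
rewrite sub0r; apply: idealN.
have : ideal_gen (pi @` ideal_set (G x (rk a).+1)) (pi (mon x a)).
  rewrite pi_mon; move: h; apply: (@mono_sub _ _ _ _ (gen _)) => b ab.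
  by apply: mem_gen; exists (mon x b); [exact: mem_mono|exact: pi_mon].
move=> /(@gen_pi_approx _ _ (mdeg a).+1) [g Gg [w Mw <-]].
by apply: idealD => //; exact: M_Grk Mw.
Qed.

(** The divisors of the division algorithm generate [J]: dividing the remainders again and again
    gives quotient series that converge, and separatedness makes the limit equation exact. *)
Lemma completed_noetherian : noetherian T.
Proof.
move=> J isJ; have [r [j [C [Jj hdiv]]]] := division completed_local (Ideal isJ).
exists r, j; apply/seteqP; split; last first.
  by apply: (@gen_sub _ _ (Ideal isJ)) => _ [i _ <-]; exact: Jj.
move=> a Ja.
have /choice [g hg] : forall p : nat * T, exists g : 'I_r -> T, J p.2 -> M y p.1 p.2 ->
    (forall i, M y (p.1 - C) (g i)) /\ M y p.1.+1 (p.2 - \sum_i g i * j i).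
  move=> [k u] /=; have [Ju|] := pselect (J u /\ M y k u); last first.
    by move=> h; exists (fun=> 0) => Ju Mu; case: h.
  by have [g hg] := hdiv k k.+1 u Ju.1 Ju.2; exists g.
pose u := fix u n := if n is k.+1 then u k - \sum_i g (k, u k) i * j i else a.
have hu n : J (u n) /\ M y n (u n).
  elim: n => [|n [Jn Mn]] /=; first by split=> //; exact: M0.
  have [h1 h2] := hg (n, u n) Jn Mn; split=> //.
  apply: (@idealB _ (Ideal isJ)) => //.
  by apply: (@ideal_sum _ (Ideal isJ)) => i _; exact: (@idealM _ (Ideal isJ)).
pose s n i := \sum_(l < n) g (val l, u l) i.
have us n : u n = a - \sum_i s n i * j i.
  elim: n => [|n IH] /=.
    by rewrite big1 ?subr0 // => i _; rewrite /s big_ord0 mul0r.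
  rewrite {1}IH -addrA -opprD -big_split; congr (_ - _); apply: eq_bigr => i _.
  by rewrite /s big_ord_recr mulrDl.
(* The quotient found at stage n + C has order at least [n], whence the shift by [C]. *)
have /choice [v hv] : forall i, exists v, forall n, K n (v - s (n + C)%N i).
  move=> i; apply: Kcomplete_seq => n; rewrite /s addSn big_ord_recr /= addrAC subrr add0r.
  have [Jn Mn] := hu (n + C)%N.
  by have [h1 _] := hg (n + C, u (n + C))%N Jn Mn; apply/KE; have := h1 i; rewrite /= addnK.
apply/gen_rangeP; exists v; apply/eqP; rewrite -subr_eq0; apply/eqP/Ksep => n.
have -> : a - \sum_i v i * j i = u (n + C)%N - \sum_i (v i - s (n + C)%N i) * j i.
  rewrite us -[RHS]addrA -opprD -big_split; congr (_ - _); apply: eq_bigr => i _.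
  by rewrite /= mulrBl addrC subrK.
apply: idealB; last by apply: ideal_sum => i _; exact: idealMr.
by apply: (@K_le _ (n + C)); [exact: leq_addr|apply/KE; have [] := hu (n + C)%N].
Qed.

End CompletedLocal.
End Completed.

(** * Localization and completion of a local ring at its maximal ideal *)

Section LocalizationMorphism.
Context (A : comPzRingType) (S : mulset A).

Lemma frac_eq a s (Ss : S s) b t (St : S t) :
  frac a Ss = frac b St <-> exists u, S u /\ u * (a * t - b * s) = 0.
Proof. exact: (cclass_eq (frac_cong S)). Qed.

Lemma loc_can_zmod_morphism : zmod_morphism (@loc_can A S).
Proof.
move=> a b; rewrite fracB; apply/frac_eq; exists 1; split; first exact: ms1.
ring.
Qed.
Lemma loc_can_monoid_morphism : monoid_morphism (@loc_can A S).
Proof.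
split=> // a b; rewrite /loc_can /frac -cclass_mul.
apply/cclass_eq; exists 1; split; first exact: ms1.
by change (1 * (a * b * (1 * 1) - a * b * 1) = 0); ring.
Qed.
HB.instance Definition _ :=
  GRing.isZmodMorphism.Build A (loc S) (@loc_can A S) loc_can_zmod_morphism.
HB.instance Definition _ :=
  GRing.isMonoidMorphism.Build A (loc S) (@loc_can A S) loc_can_monoid_morphism.

Hypothesis unitS : forall s, S s -> exists t, s * t = 1.

Lemma loc_can_inj : injective (@loc_can A S).
Proof.
move=> a b /frac_eq [u [/unitS [v uv] e]].
apply/eqP; rewrite -subr_eq0 -[_ - _]mul1r -uv mulrAC; apply/eqP.
by rewrite !mulr1 in e; rewrite e mul0r.
Qed.

Lemma loc_can_surj (z : loc S) : exists a, z = loc_can S a.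
Proof.
have [a [s [Ss ->]]] := loc_fracP z; have [t st] := unitS Ss.
exists (a * t); apply/frac_eq; exists 1; split; first exact: ms1.
by rewrite mul1r mulr1 -mulrA [t * s]mulrC st mulr1 subrr.
Qed.

End LocalizationMorphism.

Section CompletionTopology.
Context (A : comPzRingType) (J : set A).
Local Notation T := (completion J).

Lemma cclass_coherent (u v : coherent J) :
  cclass (coherent_cong J) u = cclass (coherent_cong J) v <->
  forall n, ideal_pow J n (term u n - term v n).
Proof. exact: (cclass_eq (coherent_cong J)). Qed.

Lemma compl_can_zmod_morphism : zmod_morphism (@compl_can A J).
Proof.
move=> a b; rewrite /compl_can -cclass_sub; apply/cclass_coherent => n.
by rewrite /term /= subrr; exact: (ideal0 (Ideal (ideal_pow_ideal J n))).
Qed.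
Lemma compl_can_monoid_morphism : monoid_morphism (@compl_can A J).
Proof.
split=> // a b; rewrite /compl_can -cclass_mul; apply/cclass_coherent => n.
by rewrite /term /= subrr; exact: (ideal0 (Ideal (ideal_pow_ideal J n))).
Qed.
HB.instance Definition _ :=
  GRing.isZmodMorphism.Build A T (@compl_can A J) compl_can_zmod_morphism.
HB.instance Definition _ :=
  GRing.isMonoidMorphism.Build A T (@compl_can A J) compl_can_monoid_morphism.

Let J' n : ideal A := Ideal (ideal_pow_ideal J n).

(** The kernel of the projection from the completion to A/J^n. *)
Definition compl_nbhs_set n : set T := [set u | J' n (term (repr u) n)].

Lemma compl_nbhsE n (u : coherent J) :
  compl_nbhs_set n (cclass (coherent_cong J) u) <-> J' n (term u n).
Proof.
have h := (cclass_coherent _ _).1 (cclass_repr (cclass (coherent_cong J) u)) n.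
split=> hu; last exact: (idealBl (I := J' n) h).
by apply: (@idealBl _ (J' n) _ _ _ hu); rewrite -opprB; exact: (@idealN _ (J' n)).
Qed.

Lemma compl_nbhs_ideal n : is_ideal (compl_nbhs_set n).
Proof.
split.
- by apply/compl_nbhsE; exact: (ideal0 (J' n)).
- by move=> u v hu hv; apply/compl_nbhsE; exact: (@idealD _ (J' n)).
- by move=> r u hu; apply/compl_nbhsE; exact: (@idealM _ (J' n)).
Qed.
Definition compl_nbhs n : ideal T := Ideal (compl_nbhs_ideal n).

Lemma ideal_powS n : ideal_pow J n.+1 `<=` ideal_pow J n.
Proof.
apply: (@gen_sub _ _ (J' n)) => _ [a Ja [b _ <-]]; exact: (@idealMr _ (J' n)).
Qed.

Lemma compl_nbhsS n u : compl_nbhs n.+1 u -> compl_nbhs n u.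
Proof.
move=> h; change (J' n (term (repr u) n)).
rewrite -[term _ n](subKr (term (repr u) n.+1)).
apply: (@idealB _ (J' n)); first exact: ideal_powS.
exact: termP.
Qed.

Lemma compl_nbhs_sep u : (forall n, compl_nbhs n u) -> u = 0.
Proof.
move=> h; rewrite -(cclass_repr u); apply/cclass_coherent => n.
by rewrite {2}/term /= subr0; exact: h.
Qed.

Lemma compl_nbhs_dense u n : exists a, compl_nbhs n (u - compl_can J a).
Proof.
exists (term (repr u) n); rewrite -{1}(cclass_repr u) -cclass_sub.
by apply/compl_nbhsE; rewrite /term /= subrr; exact: (ideal0 (J' n)).
Qed.

Lemma compl_nbhs_can n a : compl_nbhs n (compl_can J a) <-> ideal_pow J n a.
Proof. exact: compl_nbhsE. Qed.

Lemma compl_nbhs_complete (c : nat -> A) :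
  (forall n, ideal_pow J n (c n.+1 - c n)) ->
  exists v, forall n, compl_nbhs n (v - compl_can J (c n)).
Proof.
move=> hc; exists (cclass (coherent_cong J) (Coherent hc)) => n.
rewrite -cclass_sub; apply/compl_nbhsE.
by rewrite /term /= subrr; exact: (ideal0 (J' n)).
Qed.

End CompletionTopology.

Section CompletedLocalization.
Context (R : comPzRingType) (m : prime_ideal R) (d : nat) (x : 'I_d -> R).
Hypothesis locR : is_local (ideal_of_prime m).
Hypothesis mx : prime_set m = ideal_gen (range x).
Local Notation J := (ideal_gen (@loc_can R (prime_compl m) @` m)).
Local Notation T := (compl_loc m).

Lemma to_compl_loc_zmod_morphism : zmod_morphism (@to_compl_loc R m).
Proof. by move=> a b; rewrite /to_compl_loc !rmorphB. Qed.
Lemma to_compl_loc_monoid_morphism : monoid_morphism (@to_compl_loc R m).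
Proof. by split=> [|a b]; rewrite /to_compl_loc ?rmorph1 ?rmorphM. Qed.
HB.instance Definition _ :=
  GRing.isZmodMorphism.Build R T (@to_compl_loc R m) to_compl_loc_zmod_morphism.
HB.instance Definition _ :=
  GRing.isMonoidMorphism.Build R T (@to_compl_loc R m) to_compl_loc_monoid_morphism.

Lemma prime_compl_unit s : prime_compl m s -> exists t, s * t = 1.
Proof. exact: (localU locR). Qed.

Let surj := loc_can_surj prime_compl_unit.
Let inj := loc_can_inj prime_compl_unit.

Lemma M1_m a : M x 1 a <-> m a.
Proof. by rewrite M1_gen -mx. Qed.

(** Elements outside [m] are already units, so localizing is bijective and powers of the extended
    ideal correspond to powers of [m]. *)
Lemma ideal_pow_loc n a : ideal_pow J n (loc_can (prime_compl m) a) <-> M x n a.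
Proof.
split.
  suff h : ideal_pow J n `<=` [set z | exists b, z = loc_can (prime_compl m) b /\ M x n b].
    by move=> /h [b [/inj -> ]].
  have isI k : is_ideal [set z | exists b, z = loc_can (prime_compl m) b /\ M x k b].
    split.
    - by exists 0; rewrite rmorph0; split=> //; exact: ideal0.
    - move=> _ _ [b [-> Mb]] [c [-> Mc]]; exists (b + c).
      by rewrite rmorphD; split=> //; exact: idealD.
    - move=> z _ [b [-> Mb]]; have [r ->] := surj z; exists (r * b).
      by rewrite rmorphM; split=> //; exact: idealM.
  elim: n => [|n IH] z; first by move=> _; have [b ->] := surj z; exists b; split=> //; exact: M0.
  apply: (@gen_sub _ _ (Ideal (isI n.+1))) => _ [u /IH [b [-> Mb]] [v hv <-]].
  have : (Ideal (isI 1%N)) v.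
    by move: v hv; apply: gen_sub => _ [c mc <-]; exists c; split=> //; exact/M1_m.
  move=> [c [-> Mc]]; exists (b * c); rewrite rmorphM; split=> //.
  by rewrite -addn1; exact: M_mul.
have isI k : is_ideal [set b | ideal_pow J k (loc_can (prime_compl m) b)].
  pose Jk := Ideal (ideal_pow_ideal J k).
  split=> [|b c hb hc|r b hb] /=.
  - by rewrite rmorph0; exact: (ideal0 Jk).
  - by rewrite rmorphD; exact: (@idealD _ Jk).
  - by rewrite rmorphM; exact: (@idealM _ Jk).
elim: n a => [//|n IH] a; apply: (@mono_sub _ _ _ _ (Ideal (isI n.+1))) => b /= nb.
have /existsP [i bi] : [exists i, b i != 0%N].
  apply: contraTT nb; rewrite negb_exists mdegE => /forallP h.
  by rewrite big1 // => i _; apply/eqP; have := h i; rewrite negbK.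
have ib : (U_(i) <= b)%MM by rewrite lep1mP.
rewrite -(submK ib) monD monU rmorphM; apply: mem_gen.
exists (loc_can (prime_compl m) (mon x (b - U_(i))%MM)).
  apply: IH; apply: mem_mono => /=.
  by move: nb; rewrite -{1}(submK ib) mdegD mdeg1 addn1.
exists (loc_can (prime_compl m) (x i)) => //.
apply: mem_gen; exists (x i) => //.
by rewrite mx; apply: mem_gen; exists i.
Qed.

Local Notation K := (compl_nbhs J).

Lemma compl_loc_dense (u : T) n : exists a, K n (u - to_compl_loc m a).
Proof.
have [z hz] := compl_nbhs_dense u n; have [a e] := surj z.
by exists a; rewrite /to_compl_loc -e.
Qed.

Lemma compl_loc_can n a : K n (to_compl_loc m a) <-> M x n a.
Proof. by split=> [/compl_nbhs_can/ideal_pow_loc|/ideal_pow_loc/compl_nbhs_can]. Qed.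

Lemma compl_loc_complete (c : nat -> R) : (forall n, M x n (c n.+1 - c n)) ->
  exists v, forall n, K n (v - to_compl_loc m (c n)).
Proof.
move=> hc; apply: (compl_nbhs_complete (c := fun n => loc_can _ (c n))) => n.
by rewrite -rmorphB; exact/ideal_pow_loc.
Qed.

End CompletedLocalization.

(** * Paraclasses and forcing algebras *)

Section Paraclass.
Context (A : comPzRingType) (d : nat) (x : 'I_d -> A).
Local Notation S := (monomial_ms x [set: 'I_d]%SET).
Local Notation P := (\prod_(i < d) x i).
Local Notation can := (@loc_can A S).

Lemma fracK (B : comPzRingType) (U : mulset B) a s (Us : U s) :
  frac a Us * loc_can U s = loc_can U a.
Proof.
rewrite /loc_can /frac -cclass_mul; apply/cclass_eq; exists 1; split; first exact: ms1.
change (1 * (a * s * 1 - a * (s * 1)) = 0); ring.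
Qed.

Lemma can_unit s : S s -> exists z, can s * z = 1.
Proof. by move=> Ss; exists (frac 1 Ss); rewrite mulrC fracK rmorph1. Qed.

Lemma monomials_dvd J s : monomials x J s ->
  exists K0, forall K, (K0 <= K)%N -> exists s', s * s' = \prod_(j in J) x j ^+ K.
Proof.
move=> [e ->]; exists (\sum_j e j)%N => K hK.
exists (\prod_(j in J) x j ^+ (K - e j)); rewrite -big_split; apply: eq_bigr => j _.
rewrite /= -exprD subnKC //; apply: leq_trans hK; rewrite (bigD1 j) //=; exact: leq_addr.
Qed.

Lemma prod_setC1 i K : P ^+ K = \prod_(j in [set~ i]%SET) x j ^+ K * x i ^+ K.
Proof.
rewrite -prodrXl (bigD1 i) //= mulrC; congr (_ * _).
by apply: eq_bigl => j; rewrite !inE.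
Qed.

(** Only the x_j with j different from [i] are inverted in [z]; a large power of the full product
    clears them and leaves the factor x_i^K. *)
Lemma cech_res_clear i (z : cech x [set~ i]%SET) :
  exists K0, forall K, (K0 <= K)%N ->
    exists a, cech_res z * can (P ^+ K) = can (a * x i ^+ K).
Proof.
have [a [s [Ss ->]]] := loc_fracP z.
have [K0 hK0] := monomials_dvd Ss; exists K0 => K /hK0 [s' ss'].
exists (a * s'); rewrite /cech_res loc_mapE (prod_setC1 i) -ss' -mulrA rmorphM mulrA.
by rewrite (@fracK _ S a s (monomialsT Ss)) -rmorphM mulrA.
Qed.

(** Dividing P^k = sum of c_i x_i^(k+1) by P^(k+1) writes 1/P as a boundary. Conversely, a power of
    P clears the denominators of a boundary. *)
Lemma paraclass_eq0 : paraclass x = 0 <->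
  exists k, ideal_gen (range (fun i => x i ^+ k.+1)) (P ^+ k).
Proof.
pose v : cech x [set: 'I_d]%SET := frac (S := S) 1 (monomials_prod x).
have vP : v * can P = 1 by rewrite fracK rmorph1.
have -> : paraclass x = 0 <-> exists u, v = cech_diff (x := x) u.
  rewrite /paraclass -/v; split=> [/eqP|[u vu]].
    by rewrite -(raddf0 (\pi_(cech_top x))%qT) -Quotient.idealrBE subr0 => /asboolP.
  apply/eqP; rewrite -(raddf0 (\pi_(cech_top x))%qT) -Quotient.idealrBE subr0.
  by apply/asboolP; exists u.
split=> [[u vu]|[k /gen_rangeP [c hc]]].
  have /choice [K0 hK0] := fun i => cech_res_clear (u i).
  pose K := (\sum_i K0 i)%N.
  have /choice [a ha] : forall i, exists a, cech_res (u i) * can (P ^+ K) = can (a * x i ^+ K).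
    by move=> i; apply: hK0; rewrite /K (bigD1 i) //= leq_addr.
  have : can (P ^+ K) = can (\sum_(i < d) (-1) ^+ i * (a i * x i ^+ K) * P).
    rewrite -[LHS]mul1r -vP mulrAC vu /cech_diff !mulr_suml rmorph_sum.
    apply: eq_bigr => i _.
    by rewrite -[_ * cech_res _ * _]mulrA ha !rmorphM rmorph_sign.
  move=> /frac_eq [t [/monomials_dvd [L /(_ L (leqnn L)) [t' tt']]]].
  rewrite !mulr1 mulrBr => /eqP; rewrite subr_eq0 => /eqP e.
  have tP : t * t' = P ^+ L.
    by rewrite tt' -prodrXl; apply: eq_bigl => j; rewrite inE.
  (* P^K clears the denominators of the cochain, and P^L the factor [t] by which the equation of
     fractions holds in A. *)
  exists (K + L)%N; rewrite exprD -tP mulrA [_ * t]mulrC e mulrAC tP mulrC.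
  rewrite mulr_suml; apply: (@ideal_sum _ (gen _)) => i _.
  have -> : (-1) ^+ i * (a i * x i ^+ K) * P * P ^+ L =
      (-1) ^+ i * a i * \prod_(j in [set~ i]%SET) x j ^+ L.+1 * x i ^+ (K + L).+1.
    by rewrite -[_ * P * _]mulrA -exprS (prod_setC1 i) -addnS exprD; ring.
  by apply: (@idealM _ (gen _)); apply: mem_gen; exists i.
pose s i := \prod_(j in [set~ i]%SET) x j ^+ k.+1.
have Ss i : monomial_ms x [set~ i]%SET (s i) by exists (fun=> k.+1).
have [z Pz] : exists z, can (P ^+ k.+1) * z = 1.
  apply: can_unit; exists (fun=> k.+1); rewrite -prodrXl.
  by apply: eq_bigl => j; rewrite inE.
(* The signs cancel those of the Cech differential. *)
exists (fun i : 'I_d => frac ((-1) ^+ (i : nat) * c i) (Ss i)).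
rewrite -[LHS]mulr1 -[RHS]mulr1 -Pz !mulrA; congr (_ * z).
rewrite {1}exprS rmorphM mulrA vP mul1r hc rmorph_sum /cech_diff mulr_suml.
apply: eq_bigr => i _.
rewrite -[RHS]mulrA /cech_res loc_mapE (prod_setC1 i) -/(s i).
rewrite [can (_ * _)]rmorphM [frac _ _ * (_ * _)]mulrA.
rewrite (@fracK _ S _ (s i) (monomialsT (Ss i))) -rmorphM.
rewrite -(rmorph_sign can) -rmorphM; congr can.
by rewrite !mulrA -exprMn mulrNN mulr1 expr1n mul1r.
Qed.

End Paraclass.

Lemma seq_range (S : comPzRingType) (f : seq S) :
  [set` f] = range (fun i : 'I_(size f) => f`_i).
Proof.
apply/seteqP; split=> [a /= af|_ [i _ <-]]; last by rewrite /= mem_nth.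
have ia : (index a f < size f)%N by rewrite index_mem.
by exists (Ordinal ia) => //=; rewrite nth_index.
Qed.

Lemma gen_rmorph (A B : comPzRingType) (phi : {rmorphism A -> B}) (X : set A) (J : ideal B) :
  (forall a, X a -> J (phi a)) -> forall a, ideal_gen X a -> J (phi a).
Proof.
move=> h a [n [c [y [Xy ->]]]]; rewrite rmorph_sum; apply: ideal_sum => i _.
by rewrite rmorphM; apply: idealM; exact: h.
Qed.

Section QuotientLift.
Context (A B : comPzRingType) (I : ideal A) (phi : {rmorphism A -> B}).
Hypothesis phiI : forall a, I a -> phi a = 0.

(* The compatibility proof is an argument so that the morphism instances can be
   inferred. *)
Definition iquot_lift of (forall a, I a -> phi a = 0) := fun u : iquot I => phi (repr u).
Local Notation lift := (iquot_lift phiI).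

Lemma iquot_liftE a : lift (iproj I a) = phi a.
Proof.
apply/eqP; rewrite -subr_eq0 -rmorphB phiI //.
exact: (cong_repr (ideal_cong I)).
Qed.

Lemma iprojP (u : iquot I) : exists a, u = iproj I a.
Proof. by exists (repr u); rewrite /iproj cclass_repr. Qed.

Lemma iquot_lift_zmod : zmod_morphism lift.
Proof.
move=> u v; have [a ->] := iprojP u; have [b ->] := iprojP v.
by rewrite -rmorphB !iquot_liftE rmorphB.
Qed.
Lemma iquot_lift_monoid : monoid_morphism lift.
Proof.
split; first by rewrite -(rmorph1 (iproj I)) iquot_liftE rmorph1.
move=> u v; have [a ->] := iprojP u; have [b ->] := iprojP v.
by rewrite -rmorphM !iquot_liftE rmorphM.
Qed.
HB.instance Definition _ :=
  GRing.isZmodMorphism.Build (iquot I) B lift iquot_lift_zmod.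
HB.instance Definition _ :=
  GRing.isMonoidMorphism.Build (iquot I) B lift iquot_lift_monoid.

End QuotientLift.

(** * Maps into and out of tensor products *)

Section TensorMaps.
Context (R A B : comPzRingType).
Context (phi : {rmorphism R -> A}) (psi : {rmorphism R -> B}).
Local Notation AB := (tensor phi psi).

Lemma pure_eq (s t : seq (A * B)) :
  (forall (M : zmodType) (beta : A -> B -> M), balanced phi psi beta ->
    sum_along beta s = sum_along beta t) ->
  cclass (tensor_cong phi psi) s = cclass (tensor_cong phi psi) t.
Proof. by move=> h; apply/cclass_eq. Qed.

Definition tensor_inl (a : A) : AB := pure phi psi a 1.

Lemma tensor_inl_zmod : zmod_morphism tensor_inl.
Proof.
move=> a b; rewrite /tensor_inl /pure -cclass_sub; apply: pure_eq => M beta hb /=.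
rewrite (sum_along_cat beta [:: (a, 1)]) (sum_along_opp [:: (b, 1)] hb).
rewrite /sum_along !big_seq1 /=.
by case: hb => bl _ _; apply/eqP; rewrite eq_sym subr_eq -bl subrK.
Qed.
Lemma tensor_inl_monoid : monoid_morphism tensor_inl.
Proof.
split=> // a b; rewrite /tensor_inl /pure -cclass_mul /=.
by rewrite /tensor_mul /= mulr1.
Qed.
HB.instance Definition _ :=
  GRing.isZmodMorphism.Build A AB tensor_inl tensor_inl_zmod.
HB.instance Definition _ :=
  GRing.isMonoidMorphism.Build A AB tensor_inl tensor_inl_monoid.

Lemma tensor_inl_inr r : tensor_inl (phi r) = tensor_inr phi psi (psi r).
Proof.
apply: pure_eq => M beta [_ _ hb]; rewrite /sum_along !big_seq1 /=.
by rewrite -[phi r]mulr1 hb mulr1.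
Qed.

Section Lift.
Context (C : comPzRingType) (al : {rmorphism A -> C}) (be : {rmorphism B -> C}).
Hypothesis albe : forall r, al (phi r) = be (psi r).
Let beta a b := al a * be b.

Lemma lift_balanced : balanced phi psi beta.
Proof.
split=> [a a' b|a b b'|r a b]; rewrite /beta.
- by rewrite rmorphD mulrDl.
- by rewrite rmorphD mulrDr.
- by rewrite !rmorphM albe; ring.
Qed.

Definition tensor_lift of (forall r, al (phi r) = be (psi r)) :=
  fun u : AB => sum_along beta (repr u).
Local Notation lift := (tensor_lift albe).

Lemma tensor_liftE s :
  lift (cclass (tensor_cong phi psi) s) = sum_along beta s.
Proof. exact: (cong_repr (tensor_cong phi psi) s) lift_balanced. Qed.

Lemma tensor_lift_inr b : lift (tensor_inr phi psi b) = be b.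
Proof. by rewrite tensor_liftE /sum_along big_seq1 /beta rmorph1 mul1r. Qed.

Lemma tensor_lift_zmod : zmod_morphism lift.
Proof.
move=> u v; rewrite -(cclass_repr u) -(cclass_repr v) -cclass_sub !tensor_liftE.
by rewrite sum_along_cat (sum_along_opp _ lift_balanced).
Qed.
Lemma tensor_lift_monoid : monoid_morphism lift.
Proof.
split; first by rewrite -(rmorph1 (tensor_inr phi psi)) tensor_lift_inr rmorph1.
move=> u v; rewrite -(cclass_repr u) -(cclass_repr v) -cclass_mul !tensor_liftE.
rewrite sum_along_mul /sum_along mulr_suml; apply: eq_bigr => p _.
by rewrite mulr_sumr; apply: eq_bigr => q _; rewrite /beta !rmorphM; ring.
Qed.
HB.instance Definition _ :=
  GRing.isZmodMorphism.Build AB C lift tensor_lift_zmod.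
HB.instance Definition _ :=
  GRing.isMonoidMorphism.Build AB C lift tensor_lift_monoid.

End Lift.
End TensorMaps.

(** By [paraclass_eq0], vanishing is an ideal membership, which [sigma] carries back to A. *)
Lemma paraclass_retract (A B : comPzRingType) (phi : {rmorphism A -> B})
    (sigma : {rmorphism B -> A}) d (x : 'I_d -> A) : cancel phi sigma ->
  paraclass x != 0 -> paraclass (phi \o x) != 0.
Proof.
move=> phiK; apply: contraNneq => /paraclass_eq0 [k hk]; apply/eqP/paraclass_eq0.
exists k; rewrite -(phiK (_ ^+ _)).
have -> : phi ((\prod_(i < d) x i) ^+ k) = (\prod_(i < d) phi (x i)) ^+ k.
  by rewrite rmorphXn rmorph_prod.
move: hk; apply: (@gen_rmorph _ _ _ _ (gen _)) => _ [i _ <-].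
by rewrite /= rmorphXn phiK; apply: mem_gen; exists i.
Qed.

(** * Forcing algebras of members of the ideal *)

Section ForcingAlgebra.
Context (S : comNzRingType) (f : seq S) (h : S).

Lemma forcing_relation : exists t : 'I_(size f) -> forcing_algebra f h,
  forcing_map f h h = - \sum_i t i * forcing_map f h f`_i.
Proof.
exists (fun i => iproj (gen [set forcing_eq f h]) 'X_i).
apply/eqP; rewrite -addr_eq0 addrC.
have e0 : iproj (gen [set forcing_eq f h]) (forcing_eq f h) = 0.
  rewrite -(rmorph0 (iproj (gen [set forcing_eq f h]))).
  by apply/cclass_eq => /=; rewrite subr0; apply: mem_gen.
apply/eqP; rewrite -[RHS]e0 {3}/forcing_eq rmorphD rmorph_sum; congr (_ + _).
by apply: eq_bigr => i _; rewrite -mul_mpolyC rmorphM mulrC.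
Qed.

(** If h = sum of a_i f_i, evaluating the i-th variable at - a_i kills the forcing equation. This
    retracts the forcing algebra onto S, and every base change inherits a retraction. *)
Lemma mem_belongs : ideal_gen [set` f] h -> belongs_universally_parasolidly f h.
Proof.
rewrite seq_range => /gen_rangeP [a ha] R' psi _ m d x _ _ _ px.
rewrite cech_top_map_paraclass.
have ev0 p : gen [set forcing_eq f h] p -> meval (fun i => - a i) p = 0.
  apply: (@gen_rmorph _ _ _ _ (idl0 S)) => _ -> /=.
  rewrite /forcing_eq mevalD mevalC raddf_sum /= ha -big_split /= big1 // => i _.
  by rewrite mevalZ mevalXU mulrN mulrC addNr.
pose ev := iquot_lift ev0.
have evphi r : psi (ev (forcing_map f h r)) = psi r.
  by congr (psi _); apply: (etrans (iquot_liftE ev0 _)); exact: mevalC.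
pose sigma := tensor_lift (al := psi \o ev) (be := idfun) evphi.
apply: (@paraclass_retract _ _ _ sigma) px => b.
exact: tensor_lift_inr.
Qed.

End ForcingAlgebra.

Section LocalWith.
Context (R : comPzRingType).
Implicit Types (I : ideal R).

Lemma local_with_units (m : ideal R) : is_local m -> local_with (ideal_set m).
Proof.
move=> locm; split.
  split; [exact: idealP|exact: (local1 locm)|] => J isJ mJ.
  have [J1|J1] := pselect (J 1).
    right; apply/seteqP; split=> // a _.
    by rewrite -[a]mulr1; exact: (@idealM _ (Ideal isJ)).
  by left; apply/seteqP; split=> //; exact: (local_proper locm (I := Ideal isJ)).
move=> m' [isM' m1 mmax].
case: (mmax m) => //; [exact: idealP|exact: (local_proper locm (I := Ideal isM'))|].
by move=> e; case: (local1 locm); rewrite e.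
Qed.

(** For a non-unit [a], an ideal maximal among the proper ones containing [a] is a maximal ideal,
    hence equal to [m]. *)
Lemma units_local_with (m : ideal R) : noetherian R -> local_with (ideal_set m) -> is_local m.
Proof.
move=> noethR [[_ m1 _] mmax]; split=> // a ma.
have [[b b0 [c _ e]]|na] := pselect (idl_addM (idl0 R) a (idl_full R) 1).
  by exists c; rewrite -e b0 add0r.
have [M [[aM M1] Mmax]] := @noetherian_max _ noethR
  (fun L => idl_addM (idl0 R) a (idl_full R) `<=` L /\ ~ L 1) _ (conj (fun _ h => h) na).
case: ma; rewrite -(mmax (ideal_set M)); first by apply: aM; exact: idl_addM1.
split=> //; first exact: idealP.
move=> J isJ MJ; have [J1|J1] := pselect (J 1).
  right; apply/seteqP; split=> // b _.
  by rewrite -[b]mulr1; exact: (@idealM _ (Ideal isJ)).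
left; apply/seteqP; split=> //; apply: (Mmax (Ideal isJ)) => //.
by split=> // b /aM /MJ.
Qed.

Lemma local_prime (m : ideal R) : is_local m -> is_prime (ideal_set m).
Proof.
move=> locm; split; [exact: idealP|exact: (local1 locm)|] => a b mab.
apply: contrapT => /not_orP [/(localU locm) [c ac] mb]; apply: mb.
by rewrite -[b]mul1r -ac mulrAC; exact: idealMr.
Qed.

End LocalWith.

(** * Parasolid forcing algebras tested over a regular ring *)

Section RegularForcing.
Context (S : comNzRingType) (T : comPzRingType) (psi : {rmorphism S -> T}).
Context (d : nat) (x : 'I_d -> T).
Hypothesis locT : is_local (M x 1).
Hypothesis freeT : inits x (idl0 T) = set0.
Hypothesis noethT : noetherian T.

Lemma paraclass_free_neq0 : paraclass x != 0.
Proof.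
apply/eqP => /paraclass_eq0 [k]; rewrite -powU_gen -mon_top.
exact: (top_notin locT freeT).
Qed.

Lemma belongs_mem (f : seq S) (h : S) : belongs_universally_parasolidly f h ->
  ideal_gen (range (fun i : 'I_(size f) => psi f`_i)) (psi h).
Proof.
move=> bel; pose J := gen (range (fun i : 'I_(size f) => psi f`_i)).
have {bel} : paraclass (tensor_inr (forcing_map f h) psi \o x) != 0.
  rewrite -cech_top_map_paraclass; apply: bel.
  - split=> //; exists (M x 1); exact: local_with_units.
  - exact: (local_with_units locT).
  - exact: (krull_dim_free locT freeT noethT).
  - apply/seteqP; split=> P [Pp XP]; split=> //.
      have [isP _ _] := Pp; rewrite M1_gen.
      exact: (@gen_sub _ _ (Ideal isP)).
    by move=> _ [i _ <-]; apply: XP; exact: M1_x.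
  - exact: paraclass_free_neq0.
move/eqP => nz; apply: contrapT => Jh; apply: nz; apply/paraclass_eq0.
(* This [k] also serves as the exponent in [Q]: since [Q] is contained in [M x k], the image of [h]
   is outside J + Q. *)
have [k nk] : exists k, ~ idl_add J (M x k) (psi h).
  by apply/existsNP => hk; apply: Jh; exact: (krull_intersection locT noethT (J := J)).
exists k; pose Q := mono x (@powU d k).
have QM : Q `<=` M x k.
  apply: monoS => a [j kj] /=; rewrite mdegE (bigD1 j) //=.
  by apply: leq_trans (ltnW kj) _; exact: leq_addr.
have MQ : M x (d * k).+1 `<=` Q by apply: monoS => a /=; exact: powU_deg.
have sM v : M x 1 v -> Q (mon x (top_mnm d k) * v) by exact: top_M1.
have soc u : (forall v, M x 1 v -> Q (u * v)) ->
    idl_addM Q (mon x (top_mnm d k)) (idl_full T) u by exact: socle.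
have [||u [uJ uh]] := separate_socle locT noethT MQ sM soc (J := idl_add J Q) (h := psi h).
- by move=> q Qq; exact: idl_addr.
- by move=> [j Jj [q /QM Mq e]]; apply: nk; exists j => //; exists q.
pose inr : {rmorphism T -> tensor (forcing_map f h) psi} := tensor_inr (forcing_map f h) psi.
pose N := gen (range (fun i => inr (x i) ^+ k.+1)).
have QN q : Q q -> N (inr q).
  rewrite /Q /mono -/(ideal_set (mono x (@powU d k))) powU_gen.
  by apply: gen_rmorph => _ [i _ <-]; rewrite rmorphXn; apply: mem_gen; exists i.
have -> : \prod_(i < d) (inr \o x) i = inr (\prod_(i < d) x i) by rewrite rmorph_prod.
(* The top monomial is u h minus an element of [Q]; by the forcing relation, u h becomes a
   combination of the u f_i, which are in [Q]. *)
rewrite -rmorphXn -mon_top -[mon _ _](subKr (u * psi h)) rmorphB.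
apply: (@idealB _ N); last exact: QN.
have [t ht] := forcing_relation f h.
have hinr : inr (psi h) = - \sum_i tensor_inl (forcing_map f h) psi (t i) * inr (psi f`_i).
  apply: etrans (esym (tensor_inl_inr _ _ h)) _; rewrite ht rmorphN rmorph_sum.
  congr (- _); apply: eq_bigr => i _; rewrite rmorphM; congr (_ * _).
  exact: tensor_inl_inr.
rewrite rmorphM hinr mulrN; apply: (@idealN _ N); rewrite mulr_sumr.
apply: (@ideal_sum _ N) => i _; rewrite mulrCA -rmorphM.
apply: (@idealM _ N); apply: QN; apply: uJ; apply: idl_addl.
by apply: mem_gen; exists i.
Qed.

(** Strong induction along the chain: no new member has its image outside the ideal generated by the
    images of [f]. *)
Lemma closure_mem (I : set S) (h : S) : parasolid_closure_domain I h ->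
  ideal_gen (psi @` I) (psi h).
Proof.
move=> [f [g [If bel]]]; set c := rcons g h in bel.
pose J := gen (range (fun i : 'I_(size f) => psi f`_i)).
have hc i : (i < size c)%N -> J (psi c`_i).
  elim/ltn_ind: i => i IH ic.
  have := belongs_mem (bel i ic); apply: gen_sub => _ [j _ <-].
  have : (f ++ take i c)`_j \in f ++ take i c by exact: mem_nth.
  rewrite mem_cat => /orP[|].
    by move=> /(nthP 0) [l lf <-]; apply: mem_gen; exists (Ordinal lf).
  move=> /(nthP 0) [l]; rewrite size_take_min leq_min => /andP[li lc] <-.
  by rewrite nth_take //; exact: IH.
have := hc (size g); rewrite size_rcons ltnSn nth_rcons ltnn eqxx => /(_ isT).
apply: (@gen_sub _ _ (gen _)) => _ [i _ <-]; apply: mem_gen; exists f`_i => //.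
rewrite If; apply: mem_gen => /=; exact: mem_nth.
Qed.

End RegularForcing.

Section PrimeQuotientMorphism.
Context (R : comPzRingType) (q : prime_ideal R).

Lemma pproj_zmod_morphism : zmod_morphism (@pproj R q).
Proof. exact: (iproj_zmod (ideal_of_prime q)). Qed.
Lemma pproj_monoid_morphism : monoid_morphism (@pproj R q).
Proof. exact: (iproj_monoid (ideal_of_prime q)). Qed.
HB.instance Definition _ :=
  GRing.isZmodMorphism.Build R (pquot q) (@pproj R q) pproj_zmod_morphism.
HB.instance Definition _ :=
  GRing.isMonoidMorphism.Build R (pquot q) (@pproj R q) pproj_monoid_morphism.

(** For q = 0 every class is a singleton, so taking representatives is a morphism inverse to
    [pproj]. *)
Definition pquot_repr of (prime_set q = [set 0]) := fun u : pquot q => (repr u : R).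

Hypothesis q0 : prime_set q = [set 0].

Lemma pquot_reprK a : pquot_repr q0 (pproj q a) = a.
Proof.
have := cong_repr (ideal_cong (ideal_of_prime q)) a; rewrite /= q0 => /eqP.
by rewrite subr_eq0 => /eqP.
Qed.

Lemma pprojP (u : pquot q) : exists a, u = pproj q a.
Proof. by exists (repr u); rewrite /pproj /iproj cclass_repr. Qed.

Lemma pquot_repr_zmod : zmod_morphism (pquot_repr q0).
Proof.
move=> u v; have [a ->] := pprojP u; have [b ->] := pprojP v.
by rewrite -rmorphB !pquot_reprK.
Qed.
Lemma pquot_repr_monoid : monoid_morphism (pquot_repr q0).
Proof.
split; first by rewrite -(rmorph1 (pproj q)) pquot_reprK.
move=> u v; have [a ->] := pprojP u; have [b ->] := pprojP v.
by rewrite -rmorphM !pquot_reprK.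
Qed.
HB.instance Definition _ :=
  GRing.isZmodMorphism.Build (pquot q) R (pquot_repr q0) pquot_repr_zmod.
HB.instance Definition _ :=
  GRing.isMonoidMorphism.Build (pquot q) R (pquot_repr q0) pquot_repr_monoid.

End PrimeQuotientMorphism.

(** * The two inclusions *)

Lemma sub_parasolid_closure (R : comPzRingType) (I : set R) :
  noetherian R -> is_ideal I -> I `<=` parasolid_closure I.
Proof.
move=> noethR isI h Ih m _ q _ /=.
pose iota := @pproj _ q \o @to_compl_loc R m.
have [n [f If]] := noethR I isI.
(* The chain consists of the image of [h] alone. *)
exists [seq iota (f i) | i <- enum 'I_n], [::]; split.
  apply/seteqP; split.
    apply: (@gen_sub _ _ (gen _)) => _ [a Ia <-].
    move: Ia; rewrite If.
    apply: (@gen_rmorph _ _ iota _ (gen _)) => _ [i _ <-].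
    by apply: mem_gen => /=; apply/map_f; rewrite mem_enum.
  apply: genS => _ /= /mapP [i _ ->]; exists (f i) => //.
  by rewrite If; apply: mem_gen; exists i.
move=> c [_|//]; rewrite {}/c /= cats0; apply: mem_belongs.
move: Ih; rewrite If; apply: (@gen_rmorph _ _ iota _ (gen _)) => _ [i _ <-].
by apply: mem_gen => /=; apply/map_f; rewrite mem_enum.
Qed.

Lemma parasolid_closure_regular (R : comPzRingType) (I : set R) :
  regular_local R -> is_ideal I -> parasolid_closure I `<=` I.
Proof.
move=> [noethR [m0 [d [locm [[p hp] _] [x mx]]]]] isI h hI.
have [[isM _ _] _] := locm.
have mE : m0 = ideal_set (M x 1) by rewrite M1_gen.
have locM : is_local (M x 1) by apply: units_local_with => //; rewrite -mE.
pose m := PrimeIdeal (local_prime locM).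
have mxE : prime_set m = ideal_gen (range x) by exact: M1_gen.
have locR : is_local (ideal_of_prime m)
  by apply: IsLocal; [exact: (localU locM)|exact: (local1 locM)].
have freeR := inits_idl0_dim locM noethR hp.
pose K := compl_nbhs (ideal_gen (@loc_can R (prime_compl m) @` m)).
pose pi := @to_compl_loc R m.
pose y := pi \o x.
have KS n u : K n.+1 u -> K n u by exact: compl_nbhsS.
have Ksep u : (forall n, K n u) -> u = 0 by exact: compl_nbhs_sep.
have Kdense := compl_loc_dense locR.
have Kpi := compl_loc_can locR mxE.
have Kcomplete := compl_loc_complete locR mxE.
have locT : is_local (M y 1) := completed_local KS Ksep Kdense Kpi Kcomplete locM.
have freeT : inits y (idl0 _) = set0.
  exact: (completed_free Kdense Kpi freeR).
have noethT : noetherian (compl_loc m).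
  exact: (completed_noetherian KS Ksep Kdense Kpi Kcomplete locM).
pose q := PrimeIdeal (idl0_prime locT freeT noethT).
have qmin : is_minimal_prime q.
  split; first exact: primeP.
  move=> Q [isQ _ _] Q0; apply/seteqP; split=> // _ ->.
  by case: isQ.
have mmax : is_maximal m by have [] := local_with_units locM.
have q0 : prime_set q = [set 0] by [].
move: (hI m mmax q qmin) => /(closure_mem (pquot_repr q0) locT freeT noethT).
rewrite /= pquot_reprK => hgen.
(* Membership in the extension of [I] to the completion puts [h] in I + M x k for every [k], so [h]
   is in [I]. *)
apply: (krull_intersection locM noethR (J := Ideal isI)) => k.
apply: (gen_pi_approx Kdense Kpi).
move: hgen; apply: (@gen_sub _ _ (gen _)) => _ [u hu <-].
move: u hu; apply: (@gen_rmorph _ _ (pquot_repr q0) _ (gen _)).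
move=> _ [a Ia <-]; rewrite /= pquot_reprK; apply: mem_gen; by exists a.
Qed.

Theorem theorem4p1 (R : comPzRingType) (I : set R) :
  regular_local R -> is_ideal I -> I = parasolid_closure I.
Proof.
move=> regR isI; apply/seteqP; split; last exact: parasolid_closure_regular.
by case: regR => noethR _; exact: sub_parasolid_closure.
Qed.
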